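(* Let $\nu\ge 1$ be an integer, let $\omega=(\omega_1,\dots,\omega_\nu)\in\mathbb{R}^\nu$, and let $$u_0(x)=\sum_{n\in\mathbb{Z}^\nu}c(n)e^{ixn\omega},\qquad x\in\mathbb{R}.$$ Assume that $|c(n)|\le B_0\exp(-\kappa|n|)$ for all $n\in\mathbb{Z}^\nu$, where $B_0,\kappa>0$ are constants. Then there exists $t_0>0$ such that for $0\le t<t_0$, $x\in\mathbb{R}$, one can define a function $$u(t,x)=\sum_{n\in\mathbb{Z}^\nu}c(t,n)e^{ixn\omega}$$ with $|c(t,n)|\le 2B_0\exp(-\frac{\kappa}{2}|n|)$ for all $n \in \mathbb{Z}^\nu$, which obeys the KdV equation $$\partial_t u+\partial_x^3u+u\,\partial_xu=0$$ with the initial condition $u(0,x)=u_0(x)$. Furthermore, assume that $n\omega\ne 0$ for every $n\in\mathbb{Z}^\nu$, $n\neq 0$. If $$v(t,x)=\sum_{n\in\mathbb{Z}^\nu}h(t,n)e^{ixn\omega},$$ defined for $t$ in some interval $[0,t_2)$, $t_2>0$, and $x\in\mathbb{R}$, with $|h(t,n)|\le B\exp(-\rho|n|)$ for some constants $B,\rho>0$ (independent of $t$ and $n$), obeys the KdV equation $\partial_t v+\partial_x^3v+v\,\partial_xv=0$ with the initial condition $v(0,x)=u_0(x)$, then there exists $t_1>0$ such that $v(t,x)=u(t,x)$ for $0\le t<t_1$, $x\in\mathbb{R}$.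
   Context: For $n\in\mathbb{Z}^\nu$ and $\omega\in\mathbb{R}^\nu$, $n\omega=\sum_j n_j\omega_j$. Throughout, $|x|=\sum_j|x_j|$ denotes the $\ell^1$-norm of a vector. *)

(* Defs.v *)
(* Stdlib reals with Coquelicot; MathComp is used only for the index set Z^nu
   and for finite sums. *)
From mathcomp Require Import all_boot.
From mathcomp Require Import ssrZ.
From Stdlib Require Import Reals.
From Coquelicot Require Import Coquelicot.

Set Implicit Arguments.
Unset Strict Implicit.
Unset Printing Implicit Defensive.

Definition zvec (nu : nat) := {ffun 'I_nu -> Z}.

Definition zvec0 (nu : nat) : zvec nu := [ffun=> 0%Z].

Definition dotp (nu : nat) (n : zvec nu) (omega : 'I_nu -> R) : R :=
  \big[Rplus/0%R]_(j < nu) (IZR (n j) * omega j)%R.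

Definition norm1 (nu : nat) (n : zvec nu) : R :=
  \big[Rplus/0%R]_(j < nu) Rabs (IZR (n j)).

(* e^{i theta}, by Euler's formula: Coquelicot has no complex exponential. *)
Definition expi (theta : R) : C := (cos theta, sin theta).

(* Unordered (equivalently, absolutely convergent) sum of a complex family:
   the net of its finite partial sums, directed by inclusion, converges to l. *)
Definition has_sum (I : eqType) (f : I -> C) (l : C) : Prop :=
  forall eps : posreal, exists s0 : seq I, forall s : seq I,
    uniq s -> {subset s0 <= s} ->
    (Cmod (\big[Cplus/RtoC 0]_(i <- s) f i - l)%C < eps)%R.

Definition is_qp_series (nu : nat) (omega : 'I_nu -> R) (c : zvec nu -> C)
    (f : R -> C) : Prop :=
  forall x : R, has_sum (fun n => (c n * expi (x * dotp n omega)%R)%C) (f x).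

(* Coquelicot's [is_derive] with [locally t] restricted to D; at an endpoint
   of an interval D this is the one-sided derivative. *)
Definition is_derive_within (D : R -> Prop) (f : R -> C) (t : R) (l : C)
    : Prop :=
  @filterdiff R_AbsRing (AbsRing_NormedModule R_AbsRing) C_R_NormedModule
    f (within D (locally t)) (fun y : R => @scal R_AbsRing C_R_NormedModule y l).

(* Classical solution on [0,T) x R; complex values are differentiated in the
   real variables t and x, and the values of u outside 0 <= t < T are junk. *)
Definition solves_KdV (T : R) (u : R -> R -> C) : Prop :=
  exists ut ux uxx uxxx : R -> R -> C, forall t x : R, (0 <= t < T)%R ->
    is_derive_within (fun s => (0 <= s < T)%R) (fun s => u s x) t (ut t x) /\
    @is_derive R_AbsRing C_R_NormedModule (u t) x (ux t x) /\
    @is_derive R_AbsRing C_R_NormedModule (ux t) x (uxx t x) /\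
    @is_derive R_AbsRing C_R_NormedModule (uxx t) x (uxxx t x) /\
    (ut t x + uxxx t x + u t x * ux t x)%C = RtoC 0.

(* Main.v *)
Require Import Defs.
From HB Require Import structures.
From mathcomp Require Import all_boot.
From mathcomp Require Import ssrZ.
From Stdlib Require Import Reals Lra Lia.
From Stdlib Require Import ClassicalEpsilon FunctionalExtensionality.
From Coquelicot Require Import Coquelicot.

Set Implicit Arguments.
Unset Strict Implicit.
Unset Printing Implicit Defensive.
Local Open Scope R_scope.

(** Substituting a quasi-periodic series into the KdV equation gives, with
    [l n = dotp n omega], the system
      [c' n = i (l n)^3 c n - i (l n / 2) (c * c) n]
    for its coefficients, because [u u_x] is half the derivative of [u^2] and
    the coefficients of [u^2] are the convolution [c * c].  The linear term is
    removed by passing to [a n = exp (- i t (l n)^3) c n], which has the same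
    modulus; what remains is [a' = inter_rhs t a], whose only difficulty is the
    unbounded factor [l n], of size at most [freqC * norm1 n].

    That factor costs analyticity, and the cost is paid by a weight with a
    shrinking rate, [weight (r - g t) n], that is [exp (- (r - g t) |n|)] times
    the fixed summable factor [qweight].  On the one hand
    [sum_m weight m * weight (n - m) <= convK * weight n] for every nonnegative
    rate ([sum_le_weight_conv]), so that the quadratic term preserves bounds by
    a multiple of the weight.  On the other hand the time derivative of the
    weight is [g |n|] times the weight, so that integrating in time absorbs
    [|n|] and gains a factor [1 / g] ([weighted_gain]).  For [g] large the
    Picard map is a contraction on a time interval of length of order [1 / g];
    this gives existence ([inter_exists]), and the same contraction estimate
    applied to two solutions gives uniqueness ([inter_unique]).

    It remains to go back and forth between coefficients and functions.  From
    coefficients to functions, the exponential decay allows termwise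
    differentiation in [x] and in [t] ([coef_solves_kdv]).  From functions to
    coefficients, nonresonance makes the frequencies distinct, and then each
    coefficient is bounded by the supremum of the function ([coef_le_sup]).
    This estimate transfers to the coefficients what the equation says about
    the difference quotients in time of a given solution, and shows that they
    satisfy the system above ([coef_kdv]). *)

(** * Finite sums of real and complex numbers *)

Fact addRA : associative Rplus.
Proof. by move=> x y z; rewrite Rplus_assoc. Qed.

Fact mulRA : associative Rmult.
Proof. by move=> x y z; rewrite Rmult_assoc. Qed.

Fact addCA : associative Cplus.
Proof. by move=> x y z; rewrite Cplus_assoc. Qed.

HB.instance Definition _ :=
  Monoid.isComLaw.Build R 0 Rplus addRA Rplus_comm Rplus_0_l.
HB.instance Definition _ :=
  Monoid.isMulLaw.Build R 0 Rmult Rmult_0_l Rmult_0_r.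
HB.instance Definition _ :=
  Monoid.isComLaw.Build R 1 Rmult mulRA Rmult_comm Rmult_1_l.
HB.instance Definition _ :=
  Monoid.isAddLaw.Build R Rmult Rplus Rmult_plus_distr_r Rmult_plus_distr_l.
HB.instance Definition _ :=
  Monoid.isComLaw.Build C (RtoC 0) Cplus addCA Cplus_comm Cplus_0_l.

Notation rsum s f := (\big[Rplus/0%R]_(i <- s) f i).
Notation csum s f := (\big[Cplus/RtoC 0]_(i <- s) f i).

Lemma rsum_ge0 (I : Type) (s : seq I) (f : I -> R) :
  (forall i, 0 <= f i) -> 0 <= rsum s f.
Proof.
move=> f0; elim: s => [|x s IH]; first by rewrite big_nil; lra.
by rewrite big_cons; have := f0 x; lra.
Qed.

Lemma rsum_le (I : eqType) (s : seq I) (f g : I -> R) :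
  (forall i, i \in s -> f i <= g i) -> rsum s f <= rsum s g.
Proof.
elim: s => [|x s IH] fg; first by rewrite !big_nil; lra.
rewrite !big_cons; apply: Rplus_le_compat; first by apply: fg; rewrite mem_head.
by apply: IH => i si; apply: fg; rewrite in_cons si orbT.
Qed.

Lemma rsum_scal (I : Type) (s : seq I) (a : R) (f : I -> R) :
  rsum s (fun i => a * f i) = a * rsum s f.
Proof. by rewrite big_distrr. Qed.

Lemma csum_scal (I : Type) (s : seq I) (a : C) (f : I -> C) :
  csum s (fun i => a * f i)%C = (a * csum s f)%C.
Proof.
by elim: s => [|x s IH]; rewrite ?big_nil ?big_cons ?IH; ring.
Qed.

Lemma Cmod_csum (I : Type) (s : seq I) (f : I -> C) :
  Cmod (csum s f) <= rsum s (fun i => Cmod (f i)).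
Proof.
elim: s => [|x s IH]; first by rewrite !big_nil Cmod_0; lra.
by rewrite !big_cons; have := Cmod_triangle (f x) (csum s f); lra.
Qed.

Lemma csum_RtoC (I : Type) (s : seq I) (f : I -> R) :
  csum s (fun i => RtoC (f i)) = RtoC (rsum s f).
Proof.
by elim: s => [|x s IH]; rewrite ?big_nil ?big_cons ?IH ?RtoC_plus.
Qed.

Lemma rsum_subset (I : eqType) (s t : seq I) (f : I -> R) :
  uniq s -> {subset s <= t} -> (forall i, 0 <= f i) -> rsum s f <= rsum t f.
Proof.
move=> us st f0; elim: s t us st => [|x s IH] t.
  by move=> _ _; rewrite big_nil; apply: rsum_ge0.
move=> /= /andP[xs us] st.
have xt : x \in t by apply: st; rewrite mem_head.
rewrite (perm_big _ (perm_to_rem xt)) /= !big_cons.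
apply: Rplus_le_compat_l; apply: IH => // i si.
have : i \in t by apply: st; rewrite in_cons si orbT.
rewrite (perm_mem (perm_to_rem xt)) in_cons => /orP[/eqP ix|//].
by move: xs; rewrite -ix si.
Qed.

(** * Convergence of complex functions along a filter *)

Lemma Cminus0 (z : C) : (z - 0 = z)%C.
Proof. by ring. Qed.

Lemma Cmod_sub_le0 (z w : C) : Cmod (z - w) <= 0 -> z = w.
Proof.
move=> h; have /Cmod_eq_0 E : Cmod (z - w) = 0.
  by apply: Rle_antisym h (Cmod_ge_0 _).
by rewrite -(Cplus_0_r w) -E; ring.
Qed.

Definition tends (T : Type) (F : (T -> Prop) -> Prop) (f : T -> C) (z : C) :=
  forall eps, 0 < eps -> F (fun t => Cmod (f t - z) <= eps).

Lemma tends_const (T : Type) (F : (T -> Prop) -> Prop) (FF : Filter F) (z : C) :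
  tends F (fun=> z) z.
Proof.
move=> eps e0; apply: filter_forall => t.
have -> : (z - z = 0)%C by ring.
by rewrite Cmod_0; lra.
Qed.

Lemma tends_plus (T : Type) (F : (T -> Prop) -> Prop) (FF : Filter F)
    (f h : T -> C) (z w : C) :
  tends F f z -> tends F h w -> tends F (fun t => f t + h t)%C (z + w)%C.
Proof.
move=> cf ch eps e0; have e2 : 0 < eps / 2 by lra.
apply: filter_imp (filter_and _ _ (cf _ e2) (ch _ e2)) => s [Hf Hh].
have -> : (f s + h s - (z + w) = (f s - z) + (h s - w))%C by ring.
by apply: Rle_trans (Cmod_triangle _ _) _; lra.
Qed.

Lemma tends_mult (T : Type) (F : (T -> Prop) -> Prop) (FF : Filter F)
    (f h : T -> C) (z w : C) :
  tends F f z -> tends F h w -> tends F (fun t => f t * h t)%C (z * w)%C.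
Proof.
move=> cf ch eps e0.
pose M := Cmod z + Cmod w + 1.
have f0 := Cmod_ge_0 z; have h0 := Cmod_ge_0 w.
have M0 : 0 < M by rewrite /M; lra.
have eM : 0 < eps / M by apply: Rdiv_lt_0_compat.
have e1 : 0 < Rmin (eps / M) 1 by apply: Rmin_pos; lra.
apply: filter_imp (filter_and _ _ (cf _ e1) (ch _ eM)) => s [Hf Hh].
set u := (f s - z)%C in Hf; set v := (h s - w)%C in Hh.
have -> : (f s * h s - z * w = u * w + (u + z) * v)%C by rewrite /u /v; ring.
have u1 := Rle_trans _ _ _ Hf (Rmin_l _ _).
have u2 := Rle_trans _ _ _ Hf (Rmin_r _ _).
apply: Rle_trans (Cmod_triangle _ _) _; rewrite !Cmod_mult.
have u0 := Cmod_ge_0 u; have v0 := Cmod_ge_0 v.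
have t1 := Cmod_triangle u z.
have -> : eps = eps / M * Cmod w + (1 + Cmod z) * (eps / M).
  by rewrite /M; field; rewrite /M in M0; lra.
apply: Rplus_le_compat; first exact: Rmult_le_compat_r.
by apply: Rmult_le_compat => //; [exact: Cmod_ge_0 | lra].
Qed.

(** * Unordered sums with a summable majorant *)

Definition sum_le (I : eqType) (g : I -> R) (M : R) :=
  forall s : seq I, uniq s -> rsum s g <= M.

Definition summable (I : eqType) (g : I -> R) :=
  (forall i, 0 <= g i) /\ exists M, sum_le g M.

Section Sums.
Variable I : eqType.
Implicit Types (f : I -> C) (g : I -> R) (s : seq I).

Lemma summable_le g g' : summable g' -> (forall i, 0 <= g i <= g' i) ->
  summable g.
Proof.
move=> [g0 [M gM]] gg; split; first by move=> i; case: (gg i).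
exists M => s us; apply: Rle_trans (gM s us).
by apply: rsum_le => i _; case: (gg i).
Qed.

Lemma summable_scal g a : 0 <= a -> summable g -> summable (fun i => a * g i).
Proof.
move=> a0 [g0 [M gM]]; split; first by move=> i; apply: Rmult_le_pos.
by exists (a * M) => s us; rewrite rsum_scal; apply: Rmult_le_compat_l; auto.
Qed.

(** The Cauchy criterion for the net of finite partial sums: adding indices
    outside [s0] changes a sum dominated by [g] by at most [eps]. *)
Definition small_outside g s0 eps :=
  forall s, uniq s -> (forall i, i \in s -> i \notin s0) -> rsum s g <= eps.

Lemma summable_lub g : summable g ->
  exists m, sum_le g m /\
    forall eps, 0 < eps -> exists s, uniq s /\ m - eps < rsum s g.
Proof.
move=> [g0 [M gM]].
have [||m [ub lub]] := completeness (fun r => exists2 s, uniq s & r = rsum s g).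
- by exists M => r [s us ->]; exact: gM.
- by exists 0; exists [::]; rewrite ?big_nil.
exists m; split=> [s us|eps e0]; first by apply: ub; exists s.
apply: NNPP => H.
suff : m <= m - eps by lra.
apply: lub => r [s us ->]; apply: Rnot_lt_le => Hr.
by apply: H; exists s.
Qed.

(** Take [s0] whose sum is within [eps] of the supremum of the finite sums. *)
Lemma summable_tail g eps : summable g -> 0 < eps ->
  exists s0, uniq s0 /\ small_outside g s0 eps.
Proof.
move=> sg e0; have [m [gm /(_ eps e0) [s0 [us0 Hs0]]]] := summable_lub sg.
exists s0; split=> // s us ss0.
have : rsum (s0 ++ s) g <= m.
  apply: gm; rewrite cat_uniq us0 us andbT /=.
  by apply/hasPn => i si; apply: ss0.
by rewrite big_cat /=; lra.
Qed.

(** The finite sets that contain [s0] are cofinal, and along them the partial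
    sum moves by at most [eps]. *)
Lemma has_sum_dominated_tail f g l s0 eps :
  (forall i, Cmod (f i) <= g i) -> uniq s0 -> small_outside g s0 eps ->
  has_sum f l -> Cmod (csum s0 f - l) <= eps.
Proof.
move=> fg us0 tl fl; apply: le_epsilon => eta eta0.
have [s1 /(_ (s0 ++ [seq i <- undup s1 | i \notin s0]))] := fl (mkposreal _ eta0).
set t := filter _ _ => H.
have ut : uniq t by apply: filter_uniq; apply: undup_uniq.
have dt i : i \in t -> i \notin s0 by rewrite mem_filter => /andP[].
have {}H : Cmod (csum (s0 ++ t) f - l) < eta.
  apply: H.
    rewrite cat_uniq us0 ut andbT /=; apply/hasPn => i; exact: dt.
  move=> i si; rewrite mem_cat mem_filter mem_undup si andbT.
  by case: (i \in s0).
have Ht : Cmod (csum t f) <= eps.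
  apply: Rle_trans (Cmod_csum _ _) _; apply: Rle_trans (tl t ut dt).
  by apply: rsum_le.
rewrite big_cat /= in H.
have -> : (csum s0 f - l = (csum s0 f + csum t f - l) - csum t f)%C by ring.
apply: Rle_trans (Cmod_triangle _ _) _; rewrite Cmod_opp; lra.
Qed.

Lemma has_sum_unique f l l' : has_sum f l -> has_sum f l' -> l = l'.
Proof.
move=> fl fl'; apply/esym/Cmod_sub_le0.
apply: le_epsilon => e e0; have e2 : 0 < e / 2 by lra.
have [s1 H1] := fl (mkposreal _ e2); have [s2 H2] := fl' (mkposreal _ e2).
have {}H1 := H1 (undup (s1 ++ s2)) (undup_uniq _).
have {}H2 := H2 (undup (s1 ++ s2)) (undup_uniq _).
set z := csum _ f in H1 H2; rewrite /= in H1 H2.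
have -> : (l' - l = (z - l) - (z - l'))%C by ring.
apply: Rle_trans (Cmod_triangle _ _) _; rewrite Cmod_opp.
have S1 : {subset s1 <= undup (s1 ++ s2)}.
  by move=> i si; rewrite mem_undup mem_cat si.
have S2 : {subset s2 <= undup (s1 ++ s2)}.
  by move=> i si; rewrite mem_undup mem_cat si orbT.
by have := H1 S1; have := H2 S2; lra.
Qed.

Lemma has_sum_ext f f' l : (forall i, f i = f' i) -> has_sum f l -> has_sum f' l.
Proof.
move=> ff fl eps; have [s0 H] := fl eps; exists s0 => s us ss.
have -> : csum s f' = csum s f by apply: eq_bigr => i _; rewrite ff.
exact: H.
Qed.

Lemma has_sum_plus f f' l l' : has_sum f l -> has_sum f' l' ->
  has_sum (fun i => f i + f' i)%C (l + l')%C.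
Proof.
move=> fl fl' e; have e2 : 0 < e / 2 by have := cond_pos e; lra.
have [s1 H1] := fl (mkposreal _ e2); have [s2 H2] := fl' (mkposreal _ e2).
exists (s1 ++ s2) => s us ss; rewrite big_split /=.
have {}H1 : Cmod (csum s f - l) < e / 2.
  by apply: H1 => // i si; apply: ss; rewrite mem_cat si.
have {}H2 : Cmod (csum s f' - l') < e / 2.
  by apply: H2 => // i si; apply: ss; rewrite mem_cat si orbT.
set z := csum s f in H1 *; set z' := csum s f' in H2 *.
have -> : (z + z' - (l + l') = (z - l) + (z' - l'))%C by ring.
by apply: Rle_lt_trans (Cmod_triangle _ _) _; lra.
Qed.

Lemma has_sum_scal f l a : has_sum f l -> has_sum (fun i => a * f i)%C (a * l)%C.
Proof.
move=> fl e; have a1 : 0 < Cmod a + 1 by have := Cmod_ge_0 a; lra.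
have e2 : 0 < e / (Cmod a + 1) by apply: Rdiv_lt_0_compat => //; exact: cond_pos.
have [s1 H1] := fl (mkposreal _ e2); exists s1 => s us ss.
have {H1} /= H1 := H1 s us ss; rewrite csum_scal.
set z := csum s f in H1 *.
have -> : (a * z - a * l = a * (z - l))%C by ring.
rewrite Cmod_mult; have m0 := Cmod_ge_0 (z - l).
apply: Rle_lt_trans (_ : (Cmod a + 1) * Cmod (z - l) < _); first by nra.
have -> : pos e = (Cmod a + 1) * (e / (Cmod a + 1)) by field; lra.
exact: Rmult_lt_compat_l.
Qed.

Lemma has_sum_opp f l : has_sum f l -> has_sum (fun i => - f i)%C (- l)%C.
Proof.
move=> /(@has_sum_scal _ _ (- (1))%C) H; have -> : (- l = (- (1)) * l)%C by ring.
by apply: has_sum_ext H => i; ring.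
Qed.

Lemma has_sum_minus f f' l l' : has_sum f l -> has_sum f' l' ->
  has_sum (fun i => f i - f' i)%C (l - l')%C.
Proof. by move=> fl /has_sum_opp; apply: has_sum_plus. Qed.

Lemma has_sum_RtoC_lub g m : (forall i, 0 <= g i) -> sum_le g m ->
  (forall eps, 0 < eps -> exists s, uniq s /\ m - eps < rsum s g) ->
  has_sum (fun i => RtoC (g i)) (RtoC m).
Proof.
move=> g0 gm lub e; have [s0 [us0 H]] := lub e (cond_pos e).
exists s0 => s us ss; rewrite csum_RtoC -RtoC_minus Cmod_R.
have := gm s us; have := rsum_subset us0 ss g0.
rewrite Rabs_minus_sym; set a := rsum s0 g in H *; set b := rsum s g.
by move=> ab bm; rewrite Rabs_pos_eq; lra.
Qed.

(** The real and imaginary parts of [f] become nonnegative when [g] is added,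
    and a nonnegative family is summed by the supremum of its finite sums. *)
Lemma summable_has_sum f g : summable g -> (forall i, Cmod (f i) <= g i) ->
  exists l, has_sum f l.
Proof.
move=> sg fg.
have pos g' : (forall i, 0 <= g' i <= 2 * g i) ->
    exists l, has_sum (fun i => RtoC (g' i)) l.
  move=> g'0; have sg' : summable g'.
    by apply: summable_le (summable_scal _ sg) g'0; lra.
  have [m [gm lub]] := summable_lub sg'.
  by exists (RtoC m); apply: has_sum_RtoC_lub => // i; case: (g'0 i).
have cmp i : - g i <= Re (f i) <= g i /\ - g i <= Im (f i) <= g i.
  have := Rmax_Cmod (f i); have := fg i.
  have := Rmax_l (Rabs (f i).1) (Rabs (f i).2).
  have := Rmax_r (Rabs (f i).1) (Rabs (f i).2).
  by rewrite /Re /Im => *; split; apply/Rabs_le_between; lra.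
have [|l1 H1] := pos (fun i => Re (f i) + g i).
  by move=> i; case: (cmp i); lra.
have [|l2 H2] := pos (fun i => Im (f i) + g i).
  by move=> i; case: (cmp i); lra.
have [|l3 H3] := pos g.
  by move=> i; case: sg => /(_ i); lra.
exists ((l1 - l3) + Ci * (l2 - l3))%C.
apply: has_sum_ext
  (has_sum_plus (has_sum_minus H1 H3) (has_sum_scal Ci (has_sum_minus H2 H3))).
move=> i; rewrite !RtoC_plus [in RHS](surjective_pairing (f i)) /Re /Im.
by apply: injective_projections => /=; ring.
Qed.

Lemma has_sum_le f g l M : (forall i, Cmod (f i) <= g i) -> sum_le g M ->
  has_sum f l -> Cmod l <= M.
Proof.
move=> fg gM fl; apply: le_epsilon => e e0.
have [s0 H] := fl (mkposreal _ e0).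
have {}H : Cmod (csum (undup s0) f - l) < e.
  by apply: H => [|i]; rewrite ?undup_uniq ?mem_undup.
set z := csum _ f in H.
have -> : (l = z - (z - l))%C by ring.
apply: Rle_trans (Cmod_triangle _ _) _; rewrite Cmod_opp.
have : Cmod z <= M; last by lra.
apply: Rle_trans (Cmod_csum _ _) _; apply: Rle_trans (gM _ (undup_uniq s0)).
by apply: rsum_le => i _.
Qed.

(** Meaningful only for summable families; elsewhere an arbitrary value. *)
Definition usum f : C := epsilon (inhabits (RtoC 0)) (has_sum f).

Lemma usumP f g : summable g -> (forall i, Cmod (f i) <= g i) ->
  has_sum f (usum f).
Proof. by move=> sg fg; apply: epsilon_spec; apply: summable_has_sum fg. Qed.

(** Outside a finite set both sums are uniformly small, and on that set the
    convergence is that of finitely many terms. *)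
Lemma has_sum_dominated_convergence (T : Type) (F : (T -> Prop) -> Prop)
    (FF : Filter F) (f : T -> I -> C) (S : T -> C) (f0 : I -> C) (S0 : C) g :
  summable g ->
  F (fun t => forall i, Cmod (f t i) <= g i) -> (forall i, Cmod (f0 i) <= g i) ->
  (forall i, tends F (fun t => f t i) (f0 i)) ->
  F (fun t => has_sum (f t) (S t)) -> has_sum f0 S0 -> tends F S S0.
Proof.
move=> sg Fg f0g Ff FS fS0 eps e0; have e3 : 0 < eps / 3 by lra.
have [s0 [us0 tl]] := summable_tail sg e3.
have fin : forall s, forall eta, 0 < eta ->
    F (fun t => Cmod (csum s (f t) - csum s f0) <= eta).
  elim=> [|x s IH] eta eta0.
    apply: filter_forall => t; rewrite !big_nil.
    have -> : (RtoC 0 - RtoC 0 = 0)%C by ring.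
    by rewrite Cmod_0; lra.
  have eta2 : 0 < eta / 2 by lra.
  apply: filter_imp (filter_and _ _ (Ff x _ eta2) (IH _ eta2)) => t [H1 H2].
  rewrite !big_cons.
  have -> : (f t x + csum s (f t) - (f0 x + csum s f0) =
             (f t x - f0 x) + (csum s (f t) - csum s f0))%C by ring.
  by apply: Rle_trans (Cmod_triangle _ _) _; lra.
apply: filter_imp (filter_and _ _ (filter_and _ _ Fg FS) (fin s0 _ e3)).
move=> t [[tg tS] H].
have H1 := has_sum_dominated_tail tg us0 tl tS.
have H2 := has_sum_dominated_tail f0g us0 tl fS0.
have -> : (S t - S0 = (csum s0 f0 - S0) - (csum s0 (f t) - S t)
                      + (csum s0 (f t) - csum s0 f0))%C by ring.
set a := (csum s0 f0 - S0)%C in H2 *; set b := (csum s0 (f t) - S t)%C in H1 *.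
apply: Rle_trans (Cmod_triangle _ _) _.
by have := Cmod_triangle a (- b); rewrite Cmod_opp -/(Cminus a b); lra.
Qed.

End Sums.

Lemma has_sum_nonneg_sum_le (I : eqType) (g : I -> R) S :
  (forall i, 0 <= g i) -> has_sum (fun i => RtoC (g i)) S -> sum_le g (Cmod S).
Proof.
move=> g0 gS s us; apply: le_epsilon => e e0.
have [s0 /(_ (undup (s ++ s0)) (undup_uniq _))] := gS (mkposreal _ e0).
have -> : csum (undup (s ++ s0)) (fun i => RtoC (g i)) =
          RtoC (rsum (undup (s ++ s0)) g) by exact: csum_RtoC.
move=> /= H; have {}H : Cmod (rsum (undup (s ++ s0)) g - S) < e.
  by apply: H => i si; rewrite mem_undup mem_cat si orbT.
have : rsum s g <= rsum (undup (s ++ s0)) g.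
  by apply: rsum_subset => // i si; rewrite mem_undup mem_cat si.
move: (rsum s g) (rsum (undup (s ++ s0)) g) H => x y H xy.
have := Cmod_triangle (RtoC y - S) S.
have -> : (RtoC y - S + S = RtoC y)%C by ring.
by rewrite Cmod_R; have := Rle_abs y; lra.
Qed.

Lemma has_sum_reindex (I J : eqType) (phi : J -> I) (psi : I -> J)
    (f : I -> C) l : cancel phi psi -> cancel psi phi ->
  has_sum f l -> has_sum (fun j => f (phi j)) l.
Proof.
move=> c1 c2 fl e; have [s0 H] := fl e.
exists (map psi s0) => s us ss.
rewrite -(big_map phi xpredT); apply: H.
  by rewrite map_inj_uniq //; apply: can_inj c1.
move=> i si; apply/mapP; exists (psi i); last by rewrite c2.
by apply: ss; apply: map_f.
Qed.

(** A finite set of rows is approximated by finite subsets of each row, chosen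
    large enough to contain the given [s0]; their union is then an admissible
    finite set of pairs. *)
Lemma has_sum_fubini (I J : eqType) (f : I * J -> C) (G : I -> C) l :
  has_sum f l -> (forall i, has_sum (fun j => f (i, j)) (G i)) -> has_sum G l.
Proof.
move=> fl fG e; have e2 : 0 < e / 2 by have := cond_pos e; lra.
have [s0 H] := fl (mkposreal _ e2).
exists (map fst s0) => t ut ts.
have fin : forall t, uniq t -> forall eta, 0 < eta -> exists S : seq (I * J),
    [/\ uniq S, forall p, p \in s0 -> p.1 \in t -> p \in S,
        forall p, p \in S -> p.1 \in t & Cmod (csum S f - csum t G) <= eta].
  elim=> [|i t' IH] /=.
    move=> _ eta eta0; exists [::]; split=> //; rewrite !big_nil.
    have -> : (RtoC 0 - RtoC 0 = 0)%C by ring.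
    by rewrite Cmod_0; lra.
  move=> /andP[it' ut'] eta eta0; have eta2 : 0 < eta / 2 by lra.
  have [S [uS S0 St HS]] := IH ut' _ eta2.
  have [r0 Hr] := fG i (mkposreal _ eta2).
  pose r := undup (r0 ++ map snd s0).
  have {}Hr : Cmod (csum r (fun j => f (i, j)) - G i) < eta / 2.
    apply: Hr; first exact: undup_uniq.
    by move=> j jr; rewrite mem_undup mem_cat jr.
  exists (map (pair i) r ++ S); split.
  - rewrite cat_uniq uS andbT map_inj_uniq ?undup_uniq /=; last by move=> x y [].
    apply/hasPn => p pS; apply: contra it' => /mapP[j _ pij].
    by have := St p pS; rewrite pij.
  - move=> [i' j'] ps0 /=; rewrite in_cons => /orP[/eqP->|i't'].
      rewrite mem_cat (map_f (pair i)) // mem_undup mem_cat.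
      by rewrite (map_f snd ps0) orbT.
    by rewrite mem_cat (S0 _ ps0 i't') orbT.
  - move=> p; rewrite mem_cat in_cons => /orP[/mapP[j _ ->]|/St ->].
      by rewrite eqxx.
    by rewrite orbT.
  rewrite big_cat /= big_map big_cons; rewrite /= in Hr.
  set a := (\big[_/_]_(j <- r) f (i, j)) in Hr *; set b := csum S f in HS *.
  set d := csum t' G in HS *.
  have -> : (a + b - (G i + d) = (a - G i) + (b - d))%C by ring.
  by apply: Rle_trans (Cmod_triangle _ _) _; lra.
have e4 : 0 < e / 4 by have := cond_pos e; lra.
have [S [uS S0 _ HS]] := fin t ut _ e4.
have {}H : Cmod (csum S f - l) < e / 2.
  by apply: H => // p ps; apply: S0 => //; apply: ts; apply: map_f.
set a := csum S f in H HS *; set d := csum t G in HS *.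
have -> : (d - l = (a - l) - (a - d))%C by ring.
apply: Rle_lt_trans (Cmod_triangle _ _) _; rewrite Cmod_opp.
by have := cond_pos e; lra.
Qed.

Lemma sum_le_prod (I J : eqType) (g : I -> R) (h : J -> R) M N :
  (forall i, 0 <= g i) -> (forall j, 0 <= h j) -> sum_le g M -> sum_le h N ->
  sum_le (fun p : I * J => g p.1 * h p.2) (M * N).
Proof.
move=> g0 h0 gM hN s us.
pose s1 := undup (map fst s); pose s2 := undup (map snd s).
apply: Rle_trans (_ : rsum s1 g * rsum s2 h <= _); last first.
  apply: Rmult_le_compat; try exact: rsum_ge0.
    by apply: gM; apply: undup_uniq.
  by apply: hN; apply: undup_uniq.
have -> : rsum s1 g * rsum s2 h =
    rsum [seq (i, j) | i <- s1, j <- s2] (fun p : I * J => g p.1 * h p.2).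
  by rewrite big_allpairs_dep big_distrlr.
apply: rsum_subset => // [[i j] ps|p]; last exact: Rmult_le_pos.
apply/allpairsP; exists (i, j); split=> //=.
  by rewrite mem_undup (map_f fst ps).
by rewrite mem_undup (map_f snd ps).
Qed.

(** * One-sided derivatives and the mean value inequality *)

(** The derivative along [D] in epsilon-delta form, which is equivalent at the
    points of [D] to [is_derive_within] and, when [D] is the whole line, to
    [is_derive]; see [is_derive_withinE] and [is_derive_derw]. *)
Definition derw (D : R -> Prop) (f : R -> C) (t : R) (l : C) :=
  forall eps, 0 < eps -> within D (locally t)
    (fun s => Cmod (f s - f t - RtoC (s - t) * l)%C <= eps * Rabs (s - t)).

Lemma norm_Cmod (z : C_R_NormedModule) : norm z = Cmod z.
Proof.
rewrite /Cmod -[norm z]/(sqrt (Rabs z.1 ^ 2 + Rabs z.2 ^ 2)).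
by rewrite !RPow_abs !(Rabs_pos_eq (_ ^ 2)) //; nra.
Qed.

Lemma filterdiff_Cmod (f : R -> C) (F : (R -> Prop) -> Prop) t l :
  Filter F -> @is_filter_lim R_UniformSpace F t ->
  (forall x, @is_filter_lim R_UniformSpace F x -> x = t) ->
  @filterdiff R_AbsRing (AbsRing_NormedModule R_AbsRing) C_R_NormedModule
    f F (fun y : R => @scal R_AbsRing C_R_NormedModule y l) <->
  forall eps, 0 < eps ->
    F (fun s => Cmod (f s - f t - RtoC (s - t) * l)%C <= eps * Rabs (s - t)).
Proof.
move=> FF Ft Fu.
have E s : @norm R_AbsRing C_R_NormedModule (minus (minus (f s) (f t))
    (@scal R_AbsRing C_R_NormedModule (minus s t) l)) =
    Cmod (f s - f t - RtoC (s - t) * l)%C.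
  rewrite norm_Cmod; congr Cmod; apply: injective_projections.
    by rewrite /= /minus /plus /opp /= /scal /= /mult /=; ring.
  by rewrite /= /minus /plus /opp /= /scal /= /mult /=; ring.
split=> [[_ H] eps e0|H].
  apply: filter_imp (H t Ft (mkposreal _ e0)) => s; rewrite E.
  by rewrite -[norm (minus s t)]/(Rabs (s - t)).
split; first exact: is_linear_scal_l.
move=> x /Fu -> eps; apply: filter_imp (H eps (cond_pos eps)) => s.
by rewrite E -[norm (minus s t)]/(Rabs (s - t)).
Qed.

Lemma is_derive_withinE (D : R -> Prop) f t l : D t ->
  is_derive_within D f t l <-> derw D f t l.
Proof.
move=> Dt; apply: filterdiff_Cmod.
  by move=> P HP; apply: filter_imp HP.
move=> x Hx; apply: Req_lt_aux => eps.
have /locally_singleton /(_ Dt) := Hx _ (locally_ball x eps).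
by rewrite /ball /= /AbsRing_ball /= /abs /minus /plus /opp /= Rabs_minus_sym.
Qed.

Lemma is_derive_derw f t l :
  @is_derive R_AbsRing C_R_NormedModule f t l <-> derw (fun=> True) f t l.
Proof.
have uniq_lim x : @is_filter_lim R_UniformSpace (locally t) x -> x = t.
  by move/is_filter_lim_locally_unique.
have [E1 E2] := filterdiff_Cmod f l (filter_filter (F := locally t)) (fun P H => H) uniq_lim.
split=> [H eps e0|H].
  by have [d Hd] := E1 H eps e0; exists d => s sd _; apply: Hd.
by apply: E2 => eps e0; have [d Hd] := H eps e0; exists d => s sd; apply: Hd.
Qed.

Lemma within_imp (D D' P Q : R -> Prop) t :
  (forall s, D' s -> D s /\ (P s -> Q s)) -> within D (locally t) P ->
  within D' (locally t) Q.
Proof.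
move=> H [d Hd]; exists d => s sd D's; have [Ds PQ] := H s D's.
by apply: PQ; apply: Hd.
Qed.

Lemma derw_sub (D D' : R -> Prop) f t l : (forall s, D' s -> D s) ->
  derw D f t l -> derw D' f t l.
Proof. by move=> DD H eps /H; apply: within_imp => s /DD. Qed.

Lemma derw_ext (D : R -> Prop) f g t l : (forall s, D s -> f s = g s) -> D t ->
  derw D f t l -> derw D g t l.
Proof.
by move=> fg Dt H eps /H; apply: within_imp => s Ds; rewrite !fg.
Qed.

Lemma derw_const (D : R -> Prop) (a : C) t : derw D (fun=> a) t (RtoC 0).
Proof.
move=> eps e0; apply: filter_forall => s.
have -> : (a - a - RtoC (s - t) * 0 = 0)%C by ring.
by rewrite Cmod_0; apply: Rmult_le_pos; [lra | exact: Rabs_pos].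
Qed.

Lemma derw_plus (D : R -> Prop) f g t l m : derw D f t l -> derw D g t m ->
  derw D (fun s => f s + g s)%C t (l + m)%C.
Proof.
move=> H1 H2 eps e0; have e2 : 0 < eps / 2 by lra.
apply: filter_imp (filter_and _ _ (H1 _ e2) (H2 _ e2)) => s [h1 h2].
set a := (f s - _ - _)%C in h1; set b := (g s - _ - _)%C in h2.
have -> : (f s + g s - (f t + g t) - RtoC (s - t) * (l + m) = a + b)%C.
  by rewrite /a /b; ring.
by apply: Rle_trans (Cmod_triangle _ _) _; lra.
Qed.

Lemma derw_scal (D : R -> Prop) f t l a : derw D f t l ->
  derw D (fun s => a * f s)%C t (a * l)%C.
Proof.
move=> H eps e0; have a1 : 0 < Cmod a + 1 by have := Cmod_ge_0 a; lra.
have e2 : 0 < eps / (Cmod a + 1) by apply: Rdiv_lt_0_compat.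
apply: filter_imp (H _ e2) => s h.
set b := (f s - _ - _)%C in h.
have -> : (a * f s - a * f t - RtoC (s - t) * (a * l) = a * b)%C.
  by rewrite /b; ring.
rewrite Cmod_mult; apply: Rle_trans (_ : (Cmod a + 1) * Cmod b <= _).
  by have := Cmod_ge_0 b; nra.
have -> : eps = (Cmod a + 1) * (eps / (Cmod a + 1)) by field; lra.
by rewrite Rmult_assoc; apply: Rmult_le_compat_l; lra.
Qed.

Lemma derw_minus (D : R -> Prop) f g t l m : derw D f t l -> derw D g t m ->
  derw D (fun s => f s - g s)%C t (l - m)%C.
Proof.
move=> H1 /(@derw_scal _ _ _ _ (- (1))%C) H2; have := derw_plus H1 H2.
have -> : (l + - (1) * m = l - m)%C by ring.
move=> H eps /H; apply: within_imp => s Ds; split=> //.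
by apply: Rle_trans; apply: Req_le; congr Cmod; ring.
Qed.

Lemma derw_lipschitz (D : R -> Prop) f t l : derw D f t l ->
  within D (locally t)
    (fun s => Cmod (f s - f t)%C <= (Cmod l + 1) * Rabs (s - t)).
Proof.
move=> /(_ 1 Rlt_0_1); apply: filter_imp => s h.
set b := (f s - f t - _)%C in h.
have -> : (f s - f t = b + RtoC (s - t) * l)%C by rewrite /b; ring.
apply: Rle_trans (Cmod_triangle _ _) _; rewrite Cmod_mult Cmod_R; lra.
Qed.

Lemma within_close (D : R -> Prop) (t : R) eps : 0 < eps ->
  within D (locally t) (fun s => Rabs (s - t) <= eps).
Proof.
by move=> e0; exists (mkposreal _ e0) => s sb _; apply: Rlt_le sb.
Qed.

Lemma derw_tends (D : R -> Prop) f t l :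
  derw D f t l -> tends (within D (locally t)) f (f t).
Proof.
move=> /derw_lipschitz H eps e0; have l1 : 0 < Cmod l + 1.
  by have := Cmod_ge_0 l; lra.
have e2 : 0 < eps / (Cmod l + 1) by apply: Rdiv_lt_0_compat.
apply: filter_imp (filter_and _ _ H (@within_close D t _ e2)) => s [h1 h2].
apply: Rle_trans h1 _.
have -> : eps = (Cmod l + 1) * (eps / (Cmod l + 1)) by field; lra.
by apply: Rmult_le_compat_l; [lra | exact: h2].
Qed.

Lemma derw_mult (D : R -> Prop) f g t l m : derw D f t l -> derw D g t m ->
  derw D (fun s => f s * g s)%C t (l * g t + f t * m)%C.
Proof.
move=> H1 H2 eps e0.
pose M := Cmod (g t) + 1 + Cmod (f t) + Cmod l.
have gt0 := Cmod_ge_0 (g t); have ft0 := Cmod_ge_0 (f t).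
have l0 := Cmod_ge_0 l; have M0 : 0 < M by rewrite /M; lra.
have eM : 0 < eps / M by apply: Rdiv_lt_0_compat.
have eM1 : 0 < Rmin (eps / M) 1 by apply: Rmin_pos; lra.
apply: filter_imp (filter_and _ _ (filter_and _ _ (H1 _ eM) (H2 _ eM))
                                  (derw_tends H2 eM1)) => s [[h1 h2] h3].
set a := (f s - _ - _)%C in h1; set b := (g s - _ - _)%C in h2.
set d := (g s - g t)%C in h3.
have -> : (f s * g s - f t * g t - RtoC (s - t) * (l * g t + f t * m) =
           a * (g t + d) + f t * b + RtoC (s - t) * (l * d))%C.
  by rewrite /a /b /d; ring.
have r0 := Rabs_pos (s - t).
have hd1 : Cmod d <= eps / M by apply: Rle_trans h3 (Rmin_l _ _).
have hd2 : Cmod d <= 1 by apply: Rle_trans h3 (Rmin_r _ _).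
have t1 := Cmod_triangle (a * (g t + d) + f t * b) (RtoC (s - t) * (l * d)).
have t2 := Cmod_triangle (a * (g t + d)) (f t * b).
have t3 := Cmod_triangle (g t) d.
rewrite !Cmod_mult Cmod_R in t1 t2.
apply: Rle_trans t1 _.
have a0 := Cmod_ge_0 a; have b0 := Cmod_ge_0 b.
have E : eps * Rabs (s - t) = M * (eps / M * Rabs (s - t)) by field; lra.
set X := eps / M * Rabs (s - t) in E h1 h2.
have p1 : Cmod a * Cmod (g t + d) <= X * (Cmod (g t) + 1).
  by apply: Rmult_le_compat => //; [exact: Cmod_ge_0 | lra].
have p2 : Cmod (f t) * Cmod b <= Cmod (f t) * X by apply: Rmult_le_compat_l.
have p3 : Rabs (s - t) * (Cmod l * Cmod d) <= Cmod l * X.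
  rewrite /X; have : Cmod l * Cmod d <= Cmod l * (eps / M).
    by apply: Rmult_le_compat_l.
  by move=> p; have := Rmult_le_compat_l _ _ _ r0 p; lra.
by rewrite E /M; lra.
Qed.

Lemma derw_unique f t l m :
  derw (fun=> True) f t l -> derw (fun=> True) f t m -> l = m.
Proof.
move=> H1 H2; apply: Cmod_sub_le0.
apply: le_epsilon => e e0; have e2 : 0 < e / 2 by lra.
have [d Hd] := filter_and _ _ (H1 _ e2) (H2 _ e2).
have d0 := cond_pos d.
have td : ball t d (t + d / 2).
  rewrite /ball /= /AbsRing_ball /= /abs /minus /plus /opp /=.
  by rewrite Rabs_pos_eq; lra.
have := Hd _ td Logic.I; rewrite /=.
have -> : t + d / 2 - t = d / 2 by ring.
rewrite Rabs_pos_eq; last by lra.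
move=> [h1 h2].
set z := (f _ - f t)%C in h1 h2.
have : Cmod (RtoC (d / 2) * (l - m)) <= e * (d / 2).
  have -> : (RtoC (d / 2) * (l - m) =
    (z - RtoC (d / 2) * m) - (z - RtoC (d / 2) * l))%C by ring.
  by apply: Rle_trans (Cmod_triangle _ _) _; rewrite Cmod_opp; lra.
rewrite Cmod_mult Cmod_R Rabs_pos_eq; last by lra.
by rewrite Rmult_comm => h; have := Rmult_le_reg_r (d / 2) _ _ _ h; lra.
Qed.

Lemma is_derive_eps (D : R -> Prop) (f : R -> R) (t l : R) : is_derive f t l ->
  forall eps, 0 < eps ->
  within D (locally t) (fun s => Rabs (f s - f t - (s - t) * l) <= eps * Rabs (s - t)).
Proof.
move=> [_ /(_ t (fun P H => H)) H] eps e0.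
by have [d Hd] := H (mkposreal _ e0); exists d => s sd _; apply: Hd.
Qed.

Lemma Cmod_le_abs (z : C) : Cmod z <= Rabs z.1 + Rabs z.2.
Proof.
have a0 := Rabs_pos z.1; have b0 := Rabs_pos z.2.
rewrite -[X in _ <= X]sqrt_pow2; last by lra.
apply: sqrt_le_1_alt; rewrite -(pow2_abs z.1) -(pow2_abs z.2); nra.
Qed.

Lemma derw_pair (D : R -> Prop) (u v : R -> R) t l m :
  is_derive u t l -> is_derive v t m -> derw D (fun s => (u s, v s)) t (l, m).
Proof.
move=> Hu Hv eps e0; have e2 : 0 < eps / 2 by lra.
apply: filter_imp (filter_and _ _
  (is_derive_eps D Hu e2) (is_derive_eps D Hv e2)).
move=> s [h1 h2]; apply: Rle_trans (Cmod_le_abs _) _ => /=.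
have -> : u s + - u t + - ((s - t) * l - 0 * m) = u s - u t - (s - t) * l by ring.
have -> : v s + - v t + - ((s - t) * m + 0 * l) = v s - v t - (s - t) * m by ring.
by lra.
Qed.

(** The derivatives being one-sided at the endpoints, the inequality is
    propagated from [a] to the right: with a slope [eps] to spare, it holds up
    to the supremum of the points that it reaches, and a little beyond. *)
Lemma mean_value_ineq (D : R -> Prop) (f f' : R -> C) (phi phi' : R -> R) a b :
  a <= b -> (forall s, a <= s <= b -> D s) ->
  (forall s, a <= s <= b -> derw D f s (f' s)) ->
  (forall s, a <= s <= b -> is_derive phi s (phi' s)) ->
  (forall s, a <= s <= b -> Cmod (f' s) <= phi' s) ->
  Cmod (f b - f a) <= phi b - phi a.
Proof.
move=> ab Dab Hf Hphi ff; apply: le_epsilon => e0 e00.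
pose eps := e0 / (b - a + 1).
have eps0 : 0 < eps by apply: Rdiv_lt_0_compat; lra.
pose P x y := Cmod (f y - f x) <= phi y - phi x + eps * (y - x).
have Ptrans x y z : P x y -> P y z -> P x z.
  rewrite /P => h1 h2.
  have -> : (f z - f x = (f y - f x) + (f z - f y))%C by ring.
  by apply: Rle_trans (Cmod_triangle _ _) _; lra.
have loc m : a <= m <= b -> exists d, 0 < d /\
    forall s, a <= s <= b -> Rabs (s - m) < d ->
      (s <= m -> P s m) /\ (m <= s -> P m s).
  move=> mab; have e2 : 0 < eps / 2 by lra.
  have [d Hd] := filter_and _ _ (Hf m mab _ e2) (is_derive_eps D (Hphi m mab) e2).
  exists d; split; first exact: cond_pos.
  move=> s sab sm; have [h1 h2] := Hd s sm (Dab _ sab).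
  have h3 := ff m mab.
  have h4 : Cmod (f s - f m) <= (phi' m + eps / 2) * Rabs (s - m).
    set z := (f s - f m - _)%C in h1.
    have -> : (f s - f m = z + RtoC (s - m) * f' m)%C by rewrite /z; ring.
    apply: Rle_trans (Cmod_triangle _ _) _; rewrite Cmod_mult Cmod_R.
    by have := Rmult_le_compat_l _ _ _ (Rabs_pos (s - m)) h3; lra.
  have [h5 h6] := proj1 (Rabs_le_between _ _) h2; rewrite /P; split=> sm'.
    rewrite Rabs_left1 in h4 h5 h6; last by lra.
    have -> : (f m - f s = - (f s - f m))%C by ring.
    by rewrite Cmod_opp; lra.
  by rewrite Rabs_pos_eq in h4 h5 h6; lra.
have Paa x : P x x.
  rewrite /P; have -> : (f x - f x = 0)%C by ring.
  by rewrite Cmod_0; lra.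
pose E x := a <= x <= b /\ forall y, a <= y <= x -> P a y.
have Ea : E a.
  split; first by lra.
  by move=> y ya; have -> : y = a by lra.
have [||m [ub lub]] := completeness E.
- by exists b => x [[]].
- by exists a; exact: Ea.
have ma : a <= m by apply: ub.
have mb : m <= b by apply: lub => x [[]].
have [d [d0 Hd]] := loc m (conj ma mb).
have [x [Ex xm]] : exists x, E x /\ m - d < x.
  apply: NNPP => H; suff : m <= m - d by lra.
  by apply: lub => x Ex; apply: Rnot_lt_le => xm; apply: H; exists x.
have xm' : x <= m by apply: ub.
have [xab Px] := Ex.
have Pm : P a m.
  apply: (Ptrans a x m); first by apply: Px; lra.
  have [|h _] := Hd x xab; first by rewrite Rabs_left1; lra.
  exact: h.
have Em y : a <= y <= b -> y < m + d -> P a y.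
  move=> yab yd; case: (Rle_lt_dec m y) => ym.
    apply: Ptrans Pm _; have [|_ h2] := Hd y yab; last exact: h2.
    by apply: Rabs_def1; lra.
  have [z [[zab Pz] yz]] : exists z, E z /\ y < z.
    apply: NNPP => H; suff : m <= y by lra.
    by apply: lub => z Ez; apply: Rnot_lt_le => yz; apply: H; exists z.
  by apply: Pz; lra.
have bm : b <= m.
  apply: Rnot_lt_le => bm; pose y := Rmin b (m + d / 2).
  have y1 : y <= b := Rmin_l _ _; have y2 : y <= m + d / 2 := Rmin_r _ _.
  have y3 : m < y by apply: Rmin_glb_lt; lra.
  suff : y <= m by lra.
  apply: ub; split; first by lra.
  by move=> z zab; apply: Em; lra.
have := Pm; have -> : m = b by lra.
rewrite /P => h; apply: Rle_trans h _.
have : eps * (b - a) <= e0; last by lra.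
have E1 : e0 = eps * (b - a + 1) by rewrite /eps; field; lra.
by rewrite [X in _ <= X]E1; nra.
Qed.

Lemma mean_value_lipschitz (D : R -> Prop) (f f' : R -> C) K :
  (forall a b s, D a -> D b -> a <= s <= b -> D s) ->
  (forall s, D s -> derw D f s (f' s)) -> (forall s, D s -> Cmod (f' s) <= K) ->
  forall s t, D s -> D t -> Cmod (f s - f t) <= K * Rabs (s - t).
Proof.
move=> cD Hf fK.
have W a b : D a -> D b -> a <= b -> Cmod (f b - f a) <= K * (b - a).
  move=> Da Db ab; have -> : K * (b - a) = K * b - K * a by ring.
  have Dab s : a <= s <= b -> D s by apply: cD.
  apply: (@mean_value_ineq D f f' (Rmult K) (fun=> K)) => // s sab.
  - by apply: Hf; apply: Dab.
  - by auto_derive => //; ring.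
  - by apply: fK; apply: Dab.
move=> s t Ds Dt; case: (Rle_lt_dec s t) => st.
  rewrite Rabs_left1; last by lra.
  have -> : (f s - f t = - (f t - f s))%C by ring.
  by rewrite Cmod_opp; have := W s t Ds Dt st; lra.
by rewrite Rabs_pos_eq; [apply: W => //; lra | lra].
Qed.

(** Dominated convergence of the difference quotients. *)
Lemma derw_has_sum (I : eqType) (D : R -> Prop) (f d : R -> I -> C) (g : I -> R)
    (F : R -> C) (L : C) t :
  (forall a b s, D a -> D b -> a <= s <= b -> D s) -> D t -> summable g ->
  (forall i s, D s -> derw D (fun s => f s i) s (d s i)) ->
  (forall i s, D s -> Cmod (d s i) <= g i) ->
  (forall s, D s -> has_sum (f s) (F s)) -> has_sum (d t) L -> derw D F t L.
Proof.
move=> cD Dt sg Hd dg fF dL.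
have sg2 : summable (fun i => 2 * g i) by apply: summable_scal => //; lra.
pose h s i := (RtoC (/ (s - t)) * (f s i - f t i - RtoC (s - t) * d t i))%C.
pose H s := (RtoC (/ (s - t)) * (F s - F t - RtoC (s - t) * L))%C.
have st0 s : s <> t -> 0 < Rabs (s - t) by move=> st; apply: Rabs_pos_lt; lra.
have hE s i : Cmod (h s i) =
    Rabs (/ (s - t)) * Cmod (f s i - f t i - RtoC (s - t) * d t i).
  by rewrite Cmod_mult Cmod_R.
have conv : tends (within D (locally t)) H (RtoC 0).
  apply: (@has_sum_dominated_convergence I R (within D (locally t)) _ h H
    (fun=> RtoC 0) (RtoC 0) _ sg2).
  - exists (mkposreal _ Rlt_0_1) => s _ Ds i; rewrite hE.
    have g0 : 0 <= g i by case: sg.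
    case: (Req_dec s t) => [->|st].
      have -> : (f t i - f t i - RtoC (t - t) * d t i = 0)%C.
        by have -> : t - t = 0 by [ring]; ring.
      by rewrite Cmod_0; lra.
    rewrite Rabs_inv; have := st0 _ st; set r := Rabs (s - t) => r0.
    have -> : 2 * g i = / r * (2 * g i * r) by field; lra.
    apply: Rmult_le_compat_l; first by left; apply: Rinv_0_lt_compat.
    apply: Rle_trans (Cmod_triangle _ _) _.
    rewrite Cmod_opp Cmod_mult Cmod_R -/r.
    have := mean_value_lipschitz cD (Hd i) (dg i) Ds Dt.
    have := Rmult_le_compat_r _ _ _ (Rlt_le _ _ r0) (dg i t Dt).
    by rewrite /= -/r; lra.
  - by move=> i; rewrite Cmod_0; case: sg2.
  - move=> i eps e0; apply: filter_imp (Hd i t Dt eps e0) => s Hs.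
    have -> : (h s i - 0 = h s i)%C by ring.
    rewrite hE; case: (Req_dec s t) => [->|st].
      have -> : (f t i - f t i - RtoC (t - t) * d t i = 0)%C.
        by have -> : t - t = 0 by [ring]; ring.
      by rewrite Cmod_0; lra.
    rewrite Rabs_inv; have r0 := st0 _ st; 
    apply: (Rmult_le_reg_l (Rabs (s - t))) => //.
    rewrite -Rmult_assoc Rinv_r; last by lra.
    by lra.
  - exists (mkposreal _ Rlt_0_1) => s _ Ds; apply: has_sum_scal.
    apply: has_sum_minus; first by apply: has_sum_minus; exact: fF.
    exact: has_sum_scal.
  - have := has_sum_scal (RtoC 0) (fF t Dt); rewrite Cmult_0_l.
    by apply: has_sum_ext => i; ring.
move=> eps /conv; apply: filter_imp => s Hs.
case: (Req_dec s t) => [->|st].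
  have -> : (F t - F t - RtoC (t - t) * L = 0)%C.
    by have -> : t - t = 0 by [ring]; ring.
  rewrite Cmod_0; have -> : t - t = 0 by ring.
  by rewrite Rabs_R0; lra.
move: Hs; have -> : (H s - 0 = H s)%C by ring.
rewrite /H Cmod_mult Cmod_R Rabs_inv; have r0 := st0 _ st.
move=> Hs; have := Rmult_le_compat_l _ _ _ (Rlt_le _ _ r0) Hs.
by rewrite -Rmult_assoc Rinv_r; lra.
Qed.

Lemma derw_expi (D : R -> Prop) (a t : R) :
  derw D (fun s => expi (s * a)) t (Ci * RtoC a * expi (t * a))%C.
Proof.
have -> : (Ci * RtoC a * expi (t * a))%C = (- (a * sin (t * a)), a * cos (t * a)).
  by apply: injective_projections => /=; ring.
by apply: derw_pair; auto_derive => //; ring.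
Qed.

Lemma Cmod_expi a : Cmod (expi a) = 1.
Proof.
rewrite /Cmod /= -[RHS]sqrt_1; congr sqrt.
by have := sin2_cos2 a; rewrite /Rsqr; lra.
Qed.

Lemma expiD a b : expi (a + b) = (expi a * expi b)%C.
Proof.
by apply: injective_projections; rewrite /= ?cos_plus ?sin_plus; ring.
Qed.

Lemma expi0 : expi 0 = RtoC 1.
Proof. by rewrite /expi cos_0 sin_0. Qed.

Lemma expiN a : (expi (- a) * expi a = 1)%C.
Proof. by rewrite -expiD Rplus_opp_l expi0. Qed.

Definition cont_C (g : R -> C) := forall t, tends (locally t) g (g t).

Definition Cint (g : R -> C) (t : R) : C :=
  (RInt (fun s => (g s).1) 0 t, RInt (fun s => (g s).2) 0 t).

Lemma abs_le_Cmod (z : C) : Rabs z.1 <= Cmod z /\ Rabs z.2 <= Cmod z.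
Proof.
have := Rmax_Cmod z; have := Rmax_l (Rabs z.1) (Rabs z.2).
by have := Rmax_r (Rabs z.1) (Rabs z.2); lra.
Qed.

Lemma is_derive_RInt_continuous (g : R -> R) t :
  (forall t, continuous g t) -> is_derive (fun s => RInt g 0 s) t (g t).
Proof.
move=> gc; apply: (is_derive_RInt g _ 0 t) => //.
apply: filter_forall => s; apply: RInt_correct.
by apply: ex_RInt_continuous.
Qed.

(** An antiderivative of every continuous function: this is all that is needed
    of the integral, estimates coming from [mean_value_ineq]. *)
Lemma Cint_derw (D : R -> Prop) g t : cont_C g -> derw D (Cint g) t (g t).
Proof.
move=> gc; rewrite (surjective_pairing (g t)).
have cc s : continuous (fun s => (g s).1) s /\ continuous (fun s => (g s).2) s.
  split; apply/filterlim_locally => eps; have e2 : 0 < eps / 2.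
  - by have := cond_pos eps; lra.
  - apply: filter_imp (gc s _ e2) => r; have [h _] := abs_le_Cmod (g r - g s).
    rewrite /ball /= /AbsRing_ball /= /abs /minus /plus /opp /=.
    by move: h => /= h hh; have := cond_pos eps; lra.
  - by have := cond_pos eps; lra.
  - apply: filter_imp (gc s _ e2) => r; have [_ h] := abs_le_Cmod (g r - g s).
    rewrite /ball /= /AbsRing_ball /= /abs /minus /plus /opp /=.
    by move: h => /= h hh; have := cond_pos eps; lra.
apply: derw_pair.
  by apply: is_derive_RInt_continuous => s; case: (cc s).
by apply: is_derive_RInt_continuous => s; case: (cc s).
Qed.

Lemma Cint0 g : Cint g 0 = RtoC 0.
Proof. by rewrite /Cint !RInt_point. Qed.

(** * Weights on the lattice *)

Definition bracket (k : Z) : R := / (1 + IZR k ^ 2).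

Lemma bracket_gt0 k : 0 < bracket k.
Proof. by apply: Rinv_0_lt_compat; have := pow2_ge_0 (IZR k); lra. Qed.

(** Compare with a telescoping sum:
    [/ (1 + x^2) <= 2 / x - 2 / (x + 1)] for [x > 0]. *)
Lemma sum_bracket_nat N :
  rsum (seq.iota 0 N.+1) (fun i => bracket (Z.of_nat i)) <= 3 - 2 / INR N.+1.
Proof.
elim: N => [|N IH].
  by rewrite /= big_cons big_nil /bracket /=; lra.
rewrite -[in seq.iota _ _](addn1 N.+1) iotaD big_cat big_seq1 add0n.
apply: Rle_trans (Rplus_le_compat_r _ _ _ IH) _.
rewrite /bracket -INR_IZR_INZ [INR N.+2]S_INR.
have : 0 < INR N.+1 by rewrite S_INR; have := pos_INR N; lra.
move: (INR N.+1) => x x0.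
have E : 2 / x - 2 / (x + 1) - / (1 + x ^ 2) =
         (2 + x ^ 2 - x) / (x * (x + 1) * (1 + x ^ 2)) by field; nra.
have : 0 <= (2 + x ^ 2 - x) / (x * (x + 1) * (1 + x ^ 2)).
  by apply: Rdiv_le_0_compat; nra.
by lra.
Qed.

Lemma sum_le_bracket : sum_le bracket 6.
Proof.
move=> s us.
pose N := (\max_(k <- s) Z.abs_nat k)%N.
pose l := seq.iota 0 N.+1.
have nat_le : rsum l (fun i => bracket (Z.of_nat i)) <= 3.
  have := sum_bracket_nat N.
  have : 0 < 2 / INR N.+1.
    by apply: Rdiv_lt_0_compat; [lra | rewrite S_INR; have := pos_INR N; lra].
  by rewrite /l; lra.
apply: Rle_trans (_ : rsum ([seq Z.of_nat i | i <- l] ++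
                            [seq Z.opp (Z.of_nat i) | i <- l]) bracket <= _).
  apply: rsum_subset => // [k ks|k]; last by have := bracket_gt0 k; lra.
  have kl : Z.abs_nat k \in l.
    by rewrite mem_iota /= add0n ltnS; apply: leq_bigmax_seq.
  rewrite mem_cat; apply/orP; case: (Z.leb_spec0 0 k) => k0.
    by left; apply/mapP; exists (Z.abs_nat k) => //; lia.
  by right; apply/mapP; exists (Z.abs_nat k) => //; lia.
rewrite big_cat !big_map.
have -> : \big[Rplus/0]_(i <- l) bracket (- Z.of_nat i) =
          rsum l (fun i => bracket (Z.of_nat i)).
  by apply: eq_bigr => i _; rewrite /bracket opp_IZR; congr (/ (_ + _)); ring.
by apply: Rle_trans (Rplus_le_compat _ _ _ _ nat_le nat_le) _; lra.
Qed.

(** From [1 + a^2 <= 2 (1 + k^2) + 2 (1 + (a - k)^2)]. *)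
Lemma bracket_mul a k : bracket k * bracket (a - k) <=
  2 * bracket a * (bracket k + bracket (a - k)).
Proof.
rewrite /bracket minus_IZR.
set x := IZR a; set y := IZR k.
have hx := pow2_ge_0 x; have hy := pow2_ge_0 y; have hz := pow2_ge_0 (x - y).
have -> : 2 * / (1 + x ^ 2) * (/ (1 + y ^ 2) + / (1 + (x - y) ^ 2)) =
    (2 * / (1 + x ^ 2) * (1 + y ^ 2 + (1 + (x - y) ^ 2))) *
    (/ (1 + y ^ 2) * / (1 + (x - y) ^ 2)) by field; lra.
rewrite -[X in X <= _]Rmult_1_l; apply: Rmult_le_compat_r.
  by apply: Rmult_le_pos; left; apply: Rinv_0_lt_compat; lra.
apply: (Rmult_le_reg_r (1 + x ^ 2)); first by lra.
have -> : 2 * / (1 + x ^ 2) * (1 + y ^ 2 + (1 + (x - y) ^ 2)) * (1 + x ^ 2) =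
    2 * (1 + y ^ 2 + (1 + (x - y) ^ 2)) by field; lra.
have -> : x ^ 2 = (y + (x - y)) ^ 2 by ring.
by have := pow2_ge_0 (y - (x - y)); nra.
Qed.

Lemma sum_le_bracket_conv a :
  sum_le (fun k => bracket k * bracket (a - k)) (24 * bracket a).
Proof.
move=> s us.
apply: Rle_trans (_ : rsum s (fun k => 2 * bracket a *
    (bracket k + bracket (a - k))) <= _).
  by apply: rsum_le => k _; apply: bracket_mul.
rewrite rsum_scal big_split /=.
have h1 := sum_le_bracket us.
have h2 : rsum s (fun k => bracket (a - k)) <= 6.
  rewrite -(big_map (fun k => (a - k)%Z) xpredT); apply: sum_le_bracket.
  by rewrite map_inj_uniq // => x y; lia.
by have := bracket_gt0 a; rewrite /= in h1 h2 *; nra.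
Qed.

(** From [1 + y^2 / 4 <= (1 + y / 2)^2 <= exp y] at [y = d |k|]. *)
Lemma bracket_exp d k : 0 < d ->
  exp (- (d * Rabs (IZR k))) <= (1 + 4 / d ^ 2) * bracket k.
Proof.
move=> d0; have hk := Rabs_pos (IZR k).
rewrite /bracket -(pow2_abs (IZR k)); set x := Rabs (IZR k) in hk *.
have h : 1 + (d * x / 2) <= exp (d * x / 2).
  by apply: exp_ineq1_le.
have h2 : 1 + d ^ 2 * x ^ 2 / 4 <= exp (d * x).
  have -> : d * x = d * x / 2 + d * x / 2 by field.
  rewrite exp_plus; have : 0 <= d * x by nra.
  by move=> dx; have := Rmult_le_compat _ _ _ _ _ _ h h; nra.
rewrite exp_Ropp; have e0 := exp_pos (d * x).
have d20 : 0 < d ^ 2 by nra.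
apply: (Rmult_le_reg_r (exp (d * x) * (1 + x ^ 2))); first by nra.
have -> : / exp (d * x) * (exp (d * x) * (1 + x ^ 2)) = 1 + x ^ 2 by field; lra.
have -> : (1 + 4 / d ^ 2) * / (1 + x ^ 2) * (exp (d * x) * (1 + x ^ 2)) =
    (1 + 4 / d ^ 2) * exp (d * x) by field; nra.
apply: Rle_trans (_ : (1 + 4 / d ^ 2) * (1 + d ^ 2 * x ^ 2 / 4) <= _).
  have -> : (1 + 4 / d ^ 2) * (1 + d ^ 2 * x ^ 2 / 4) =
      1 + x ^ 2 + 4 / d ^ 2 + d ^ 2 * x ^ 2 / 4 by field; lra.
  have : 0 < 4 / d ^ 2 by apply: Rdiv_lt_0_compat; lra.
  by nra.
apply: Rmult_le_compat_l => //.
by have : 0 < 4 / d ^ 2 by [apply: Rdiv_lt_0_compat; lra]; lra.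
Qed.

Lemma rprod_ge0 (I : Type) (s : seq I) (f : I -> R) :
  (forall i, 0 <= f i) -> 0 <= \big[Rmult/1]_(i <- s) f i.
Proof.
move=> f0; elim: s => [|x s IH]; first by rewrite big_nil; lra.
by rewrite big_cons; apply: Rmult_le_pos.
Qed.

Lemma rprod_le (I : Type) (s : seq I) (f g : I -> R) :
  (forall i, 0 <= f i <= g i) ->
  \big[Rmult/1]_(i <- s) f i <= \big[Rmult/1]_(i <- s) g i.
Proof.
move=> fg; elim: s => [|x s IH]; first by rewrite !big_nil; lra.
rewrite !big_cons; apply: Rmult_le_compat => //; try by case: (fg x).
by apply: rprod_ge0 => i; case: (fg i).
Qed.

Section Lattice.
Variable nu : nat.
Implicit Types (n m : zvec nu).

Definition zsub n m : zvec nu := [ffun j => (n j - m j)%Z].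

(** A finite set of lattice points lies in a product of finite sets, over which
    the sum of the products is the product of the sums. *)
Lemma sum_le_zvec_prod (F : 'I_nu -> Z -> R) (M : 'I_nu -> R) :
  (forall j k, 0 <= F j k) -> (forall j, sum_le (F j) (M j)) ->
  sum_le (fun n : zvec nu => \big[Rmult/1]_j F j (n j)) (\big[Rmult/1]_j M j).
Proof.
move=> F0 FM s us.
pose t := undup (flatten [seq [seq n j | j <- enum 'I_nu] | n : zvec nu <- s]).
have tP n j : n \in s -> n j \in t.
  move=> ns; rewrite mem_undup; apply/flattenP.
  exists [seq n j | j <- enum 'I_nu]; first by apply: map_f.
  by apply: map_f; rewrite mem_enum.
pose U := seq_sub t.
pose box : seq (zvec nu) :=
  [seq [ffun j => ssval (h j)] | h : {ffun 'I_nu -> U} <- index_enum _].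
apply: Rle_trans (_ : rsum box (fun n => \big[Rmult/1]_j F j (n j)) <= _).
  apply: rsum_subset => // [n ns|n]; last by apply: rprod_ge0.
  apply/mapP; exists [ffun j => SeqSub (tP n j ns)]; last first.
    by apply/ffunP => j; rewrite !ffunE.
  exact: mem_index_enum.
rewrite big_map.
have -> : \big[Rplus/0]_(h : {ffun 'I_nu -> U})
    \big[Rmult/1]_j F j ([ffun j0 => ssval (h j0)] j) =
    \big[Rplus/0]_(h : {ffun 'I_nu -> U}) \big[Rmult/1]_j F j (ssval (h j)).
  by apply: eq_bigr => h _; apply: eq_bigr => j _; rewrite ffunE.
rewrite -(bigA_distr_bigA (fun j (k : U) => F j (ssval k))).
apply: rprod_le => j; split; first by apply: rsum_ge0.
rewrite -(big_map (fun k : U => ssval k) xpredT (F j)).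
apply: FM; rewrite map_inj_uniq; last exact: val_inj.
exact: index_enum_uniq.
Qed.

Lemma norm1_ge0 n : 0 <= norm1 n.
Proof. by apply: rsum_ge0 => j; apply: Rabs_pos. Qed.

Lemma norm1_triangle n m : norm1 n <= norm1 m + norm1 (zsub n m).
Proof.
rewrite /norm1 -big_split; apply: rsum_le => j _ /=.
rewrite ffunE minus_IZR; have := Rabs_triang (IZR (m j)) (IZR (n j) - IZR (m j)).
by have -> : IZR (m j) + (IZR (n j) - IZR (m j)) = IZR (n j) by ring.
Qed.

Lemma dotp_zsub omega n m : dotp n omega = dotp m omega + dotp (zsub n m) omega.
Proof.
rewrite /dotp -big_split; apply: eq_bigr => j _ /=.
by rewrite ffunE minus_IZR; ring.
Qed.

Lemma dotp_le omega n :
  Rabs (dotp n omega) <= (1 + \big[Rplus/0]_j Rabs (omega j)) * norm1 n.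
Proof.
set S := \big[Rplus/0]_j _.
apply: Rle_trans (_ : \big[Rplus/0]_j (S * Rabs (IZR (n j))) <= _).
  rewrite /dotp; elim/big_rec2: _ => [|j x y _ IH]; first by rewrite Rabs_R0; lra.
  apply: Rle_trans (Rabs_triang _ _) _; rewrite Rabs_mult.
  have : Rabs (omega j) <= S.
    rewrite /S (bigD1 j) //= -[X in X <= _]Rplus_0_r; apply: Rplus_le_compat_l.
    by elim/big_rec: _ => [|i z _ z0]; [lra | have := Rabs_pos (omega i); lra].
  by have := Rabs_pos (IZR (n j)); nra.
rewrite rsum_scal -/(norm1 n).
by have := norm1_ge0 n; lra.
Qed.

Lemma exp_norm1 d n :
  exp (- (d * norm1 n)) = \big[Rmult/1]_j exp (- (d * Rabs (IZR (n j)))).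
Proof.
rewrite /norm1; elim/big_rec2: _ => [|j x y _ <-].
  by rewrite Rmult_0_r Ropp_0 exp_0.
by rewrite -exp_plus; congr exp; ring.
Qed.

Definition qweight n := \big[Rmult/1]_j bracket (n j).

Lemma qweight_ge0 n : 0 <= qweight n.
Proof. by apply: rprod_ge0 => j; have := bracket_gt0 (n j); lra. Qed.

Lemma qweight_le1 n : qweight n <= 1.
Proof.
apply: Rle_trans (_ : \big[Rmult/1]_(j < nu) 1 <= _).
  apply: rprod_le => j; have := bracket_gt0 (n j); rewrite /bracket => ?.
  split; first by lra.
  by rewrite -Rinv_1; apply: Rinv_le_contravar; have := pow2_ge_0 (IZR (n j)); lra.
by elim/big_rec: _ => [|j x _ h]; lra.
Qed.

(** The constant of [sum_le_bracket_conv], once for each coordinate. *)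
Definition convK : R := \big[Rmult/1]_(j < nu) 24.

Lemma convK_gt0 : 0 < convK.
Proof. by rewrite /convK; elim/big_rec: _ => [|j x _ h]; lra. Qed.

(** The exponential alone is not stable under convolution: the sum of
    [exp (- r (|m| + |n - m|))] over [m], divided by [exp (- r |n|)], is not
    bounded in [n].  The factor [qweight] repairs this at the price of an
    arbitrarily small loss in the rate, see [exp_le_weight]. *)
Definition weight r n := qweight n * exp (- (r * norm1 n)).

Lemma weight_ge0 r n : 0 <= weight r n.
Proof. by apply: Rmult_le_pos; [apply: qweight_ge0 | left; apply: exp_pos]. Qed.

Lemma weight_le_exp r n : weight r n <= exp (- (r * norm1 n)).
Proof.
rewrite -[X in _ <= X]Rmult_1_l; apply: Rmult_le_compat_r (qweight_le1 n).
by left; apply: exp_pos.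
Qed.

Lemma exp_le_exp x y : x <= y -> exp x <= exp y.
Proof. by case=> [/exp_increasing|->]; lra. Qed.

Lemma weight_decr r r' n : r <= r' -> weight r' n <= weight r n.
Proof.
move=> rr; apply: Rmult_le_compat_l (qweight_ge0 n) _.
by apply: exp_le_exp; have := norm1_ge0 n; nra.
Qed.

Lemma exp_le_weight r r' : r < r' -> exists2 A, 0 < A &
  forall n, exp (- (r' * norm1 n)) <= A * weight r n.
Proof.
move=> rr; have d0 : 0 < r' - r by lra.
pose c := 1 + 4 / (r' - r) ^ 2.
have c0 : 0 < c.
  by rewrite /c; have := Rdiv_lt_0_compat 4 _ _ (pow_lt _ 2 d0); lra.
exists (\big[Rmult/1]_(j < nu) c) => [|n].
  by elim/big_rec: _ => [|j x _ h]; [lra | apply: Rmult_lt_0_compat].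
have -> : - (r' * norm1 n) = - ((r' - r) * norm1 n) + - (r * norm1 n) by ring.
rewrite exp_plus /weight -Rmult_assoc; apply: Rmult_le_compat_r.
  by left; apply: exp_pos.
rewrite exp_norm1 /qweight -big_split /=; apply: rprod_le => j; split.
  by left; apply: exp_pos.
exact: bracket_exp.
Qed.

(** The exponentials multiply to at most [exp (- r |n|)] by the triangle
    inequality, and the remaining sum factors over the coordinates. *)
Lemma sum_le_weight_conv r n : 0 <= r ->
  sum_le (fun m => weight r m * weight r (zsub n m)) (convK * weight r n).
Proof.
move=> r0 s us.
have qc : sum_le (fun m => qweight m * qweight (zsub n m)) (convK * qweight n).
  have := @sum_le_zvec_prod (fun j k => bracket k * bracket (n j - k))
    (fun j => 24 * bracket (n j)) _ (fun j => @sum_le_bracket_conv (n j)).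
  rewrite /convK /qweight -big_split => H t ut; apply: Rle_trans (H _ t ut).
    apply: rsum_le => m _; rewrite -big_split /=; apply: Req_le.
    by apply: eq_bigr => j _; rewrite ffunE.
  by move=> j k; apply: Rmult_le_pos; left; apply: bracket_gt0.
apply: Rle_trans (_ : rsum s (fun m => exp (- (r * norm1 n)) *
   (qweight m * qweight (zsub n m))) <= _); last first.
  rewrite rsum_scal /weight; have := qc s us; have := exp_pos (- (r * norm1 n)).
  by move=> e0 /(Rmult_le_compat_l _ _ _ (Rlt_le _ _ e0)); rewrite /=; lra.
apply: rsum_le => m _; rewrite /weight.
have -> : qweight m * exp (- (r * norm1 m)) *
   (qweight (zsub n m) * exp (- (r * norm1 (zsub n m)))) =
   (exp (- (r * norm1 m) + - (r * norm1 (zsub n m)))) *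
   (qweight m * qweight (zsub n m)) by rewrite exp_plus; ring.
apply: Rmult_le_compat_r; first by apply: Rmult_le_pos; apply: qweight_ge0.
by apply: exp_le_exp; have := norm1_triangle n m; nra.
Qed.

Lemma summable_weight r : 0 <= r -> summable (weight r).
Proof.
move=> r0; have sq : summable qweight.
  split; first exact: qweight_ge0.
  exists (\big[Rmult/1]_(j < nu) 6); apply: (@sum_le_zvec_prod (fun=> bracket)).
    by move=> _ k; left; apply: bracket_gt0.
  by move=> _; apply: sum_le_bracket.
apply: summable_le sq _ => n; split; first exact: weight_ge0.
rewrite -[X in _ <= X]Rmult_1_r; apply: Rmult_le_compat_l (qweight_ge0 n) _.
by rewrite -exp_0; apply: exp_le_exp; have := norm1_ge0 n; nra.
Qed.

(** * Convolution *)

Definition conv (a b : zvec nu -> C) n := usum (fun m => a m * b (zsub n m))%C.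

Definition wbounded A r (a : zvec nu -> C) :=
  forall n, Cmod (a n) <= A * weight r n.

Lemma wbounded_weaken A r r' a :
  0 <= A -> r' <= r -> wbounded A r a -> wbounded A r' a.
Proof.
move=> A0 rr aA n; apply: Rle_trans (aA n) _.
by apply: Rmult_le_compat_l => //; apply: weight_decr.
Qed.

Section ConvBound.
Variables (r A B : R) (a b : zvec nu -> C).
Hypotheses (r0 : 0 <= r) (A0 : 0 <= A) (B0 : 0 <= B).
Hypotheses (aA : wbounded A r a) (bB : wbounded B r b).

Let major n m := A * B * (weight r m * weight r (zsub n m)).

Lemma conv_term_le n m : Cmod (a m * b (zsub n m)) <= major n m.
Proof.
rewrite Cmod_mult /major.
have -> : A * B * (weight r m * weight r (zsub n m)) =
  (A * weight r m) * (B * weight r (zsub n m)) by ring.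
by apply: Rmult_le_compat => //; apply: Cmod_ge_0.
Qed.

Let major_sum n : sum_le (major n) (A * B * (convK * weight r n)).
Proof.
move=> s us; rewrite rsum_scal; apply: Rmult_le_compat_l.
  exact: Rmult_le_pos.
exact: sum_le_weight_conv.
Qed.

Lemma summable_conv n : summable (major n).
Proof.
split; last by exists (A * B * (convK * weight r n)).
move=> m; apply: Rmult_le_pos; first exact: Rmult_le_pos.
by apply: Rmult_le_pos; apply: weight_ge0.
Qed.

Lemma convP n : has_sum (fun m => a m * b (zsub n m))%C (conv a b n).
Proof. by apply: usumP (summable_conv n) _; apply: conv_term_le. Qed.

Lemma conv_bounded : wbounded (A * B * convK) r (conv a b).
Proof.
by move=> n; rewrite Rmult_assoc; apply: has_sum_le (convP n) => //; apply: conv_term_le.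
Qed.

End ConvBound.

Lemma conv_tends (T : Type) (F : (T -> Prop) -> Prop) (FF : Filter F) r A
    (a : T -> zvec nu -> C) (a0 : zvec nu -> C) n : 0 <= r -> 0 <= A ->
  F (fun s => wbounded A r (a s)) -> wbounded A r a0 ->
  (forall m, tends F (fun s => a s m) (a0 m)) ->
  tends F (fun s => conv (a s) (a s) n) (conv a0 a0 n).
Proof.
move=> r0 A0 aA a0A aa0.
apply: (@has_sum_dominated_convergence _ T F _
  (fun s m => a s m * a s (zsub n m))%C _ (fun m => a0 m * a0 (zsub n m))%C _
  (fun m => A * A * (weight r m * weight r (zsub n m)))).
- exact: (summable_conv r0 A0 A0 n).
- by apply: filter_imp aA => s aA m; apply: conv_term_le.
- by move=> m; apply: conv_term_le.
- by move=> m; apply: tends_mult.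
- by apply: filter_imp aA => s aA; apply: (convP r0 A0 A0).
- exact: (convP r0 A0 A0).
Qed.

(** [a * a - b * b = a * (a - b) + (a - b) * b]. *)
Lemma conv_diff r A d (a b : zvec nu -> C) : 0 <= r -> 0 <= A -> 0 <= d ->
  wbounded A r a -> wbounded A r b -> wbounded d r (fun n => a n - b n)%C ->
  wbounded (2 * A * d * convK) r (fun n => conv a a n - conv b b n)%C.
Proof.
move=> r0 A0 d0 aA bA abd n.
pose e := (fun n => a n - b n)%C.
have E : (conv a a n - conv b b n = conv a e n + conv e b n)%C.
  apply: (@has_sum_unique _ (fun m => a m * a (zsub n m) - b m * b (zsub n m))%C).
    by apply: has_sum_minus;
      [exact: (convP r0 A0 A0 aA aA n) | exact: (convP r0 A0 A0 bA bA n)].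
  apply: has_sum_ext (has_sum_plus (convP r0 A0 d0 aA abd n)
                                   (convP r0 d0 A0 abd bA n)).
  by move=> m; rewrite /e /=; ring.
rewrite E; apply: Rle_trans (Cmod_triangle _ _) _.
have := conv_bounded r0 A0 d0 aA abd n; have := conv_bounded r0 d0 A0 abd bA n.
by rewrite -/e; lra.
Qed.

(** The family of the products of two terms, indexed by pairs, is summed once by
    rows, which gives the product of the sums, and once along the lines of
    constant total index, which gives the convolution. *)
Lemma qp_series_mult (omega : 'I_nu -> R) r A a b f g : 0 <= r -> 0 <= A ->
  wbounded A r a -> wbounded A r b -> is_qp_series omega a f ->
  is_qp_series omega b g ->
  is_qp_series omega (conv a b) (fun x => f x * g x)%C.
Proof.
move=> r0 A0 aA bA fa gb x.
pose ea n := (a n * expi (x * dotp n omega))%C.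
pose eb n := (b n * expi (x * dotp n omega))%C.
have eaA n : Cmod (ea n) <= A * weight r n by rewrite Cmod_mult Cmod_expi Rmult_1_r.
have ebA n : Cmod (eb n) <= A * weight r n by rewrite Cmod_mult Cmod_expi Rmult_1_r.
have [w0 [M wM]] := summable_scal A0 (summable_weight r0).
have pair_sum : exists l, has_sum (fun p => ea p.1 * eb p.2)%C l.
  apply: (@summable_has_sum _ _ (fun p => (A * weight r p.1) * (A * weight r p.2))).
    split; first by move=> p; apply: Rmult_le_pos.
    by exists (M * M); exact: (sum_le_prod w0 w0 wM wM).
  move=> p; rewrite Cmod_mult; apply: Rmult_le_compat => //; exact: Cmod_ge_0.
have [l Hl] := pair_sum.
have lE : l = (f x * g x)%C.
  have H1 : has_sum (fun n => g x * ea n)%C l.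
    apply: has_sum_fubini Hl _ => n /=; rewrite Cmult_comm.
    by apply: has_sum_scal; apply: gb.
  by rewrite (has_sum_unique H1 (has_sum_scal (g x) (fa x))) Cmult_comm.
rewrite -lE.
apply: (@has_sum_fubini _ _ (fun p => ea p.2 * eb (zsub p.1 p.2))%C).
  have H := @has_sum_reindex _ _ (fun p => (p.2, zsub p.1 p.2))
     (fun p => ([ffun j => (p.1 j + p.2 j)%Z], p.1)) _ l _ _ Hl.
  apply: H => [[n m]|[n m]] /=.
    congr (_, _); apply/ffunP => j; rewrite !ffunE.
    exact: (Zplus_minus (m j) (n j)).
  congr (_, _); apply/ffunP => j; rewrite !ffunE.
  exact: (Z.add_simpl_l (n j) (m j)).
move=> n /=; rewrite Cmult_comm.
apply: has_sum_ext (has_sum_scal _ (convP r0 A0 A0 aA bA n)) => m.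
by rewrite /ea /eb (dotp_zsub omega n m) Rmult_plus_distr_l expiD; ring.
Qed.

End Lattice.

(** * Coefficients are controlled by the sum *)

Section CoefBound.
Variables (I : eqType) (lam : I -> R) (g : I -> R) (M : R).
Hypotheses (lam_inj : forall i j, i <> j -> lam i <> lam j) (sg : summable g).

Definition exp_series (a : I -> C) (f : R -> C) :=
  forall x, has_sum (fun i => a i * expi (x * lam i))%C (f x).

(** If [tau] makes [exp (i tau (lam k - lam i0)) = -1], then averaging [f x] and
    [exp (- i tau lam i0) f (x + tau)] removes the frequency of [k] and keeps
    the coefficient of [i0], increasing neither the supremum of the function
    nor the modulus of any coefficient.  This is repeated over [s]. *)
Lemma kill_frequencies (i0 : I) (s : seq I) (a : I -> C) (f : R -> C) :
  i0 \notin s -> (forall i, Cmod (a i) <= g i) -> exp_series a f ->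
  (forall x, Cmod (f x) <= M) -> exists (a' : I -> C) (f' : R -> C),
  [/\ forall i, Cmod (a' i) <= g i, a' i0 = a i0,
      forall i, i \in s -> a' i = RtoC 0, exp_series a' f'
    & forall x, Cmod (f' x) <= M].
Proof.
move=> + ag af fM; elim: s => [|k s IH]; first by exists a, f.
rewrite in_cons negb_or => /andP[/eqP i0k i0s].
have [a' [f' [a'g a'0 a's a'f f'M]]] := IH i0s.
have dk : lam k - lam i0 <> 0 by have := lam_inj (not_eq_sym i0k); lra.
pose tau := PI / (lam k - lam i0).
pose w i := ((1 + expi (tau * (lam i - lam i0))) / 2)%C.
have two0 : RtoC 2 <> 0%C by move=> []; lra.
have half z z' N : Cmod z <= N -> Cmod z' <= N -> Cmod ((z + z') / 2)%C <= N.
  move=> zN z'N; rewrite Cmod_div // Cmod_R Rabs_pos_eq; last by lra.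
  by have := Cmod_triangle z z'; lra.
exists (fun i => a' i * w i)%C.
exists (fun x => (f' x + expi (- (tau * lam i0)) * f' (x + tau)%R) / 2)%C; split.
- move=> i; rewrite Cmod_mult -[X in _ <= X]Rmult_1_r.
  apply: Rmult_le_compat => //; try exact: Cmod_ge_0.
  by apply: half; rewrite ?Cmod_1 ?Cmod_expi; lra.
- rewrite /w a'0; have -> : tau * (lam i0 - lam i0) = 0 by ring.
  by rewrite expi0; field.
- move=> i; rewrite in_cons => /orP[/eqP->|/a's->]; last by ring.
  rewrite /w /tau; have -> : PI / (lam k - lam i0) * (lam k - lam i0) = PI by field.
  have -> : (1 + expi PI = 0)%C.
    by apply: injective_projections => /=; rewrite ?cos_PI ?sin_PI; ring.
  by rewrite /Cdiv; ring.
- move=> x.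
  have := has_sum_scal (/ 2)%C (has_sum_plus (a'f x)
     (has_sum_scal (expi (- (tau * lam i0))) (a'f (x + tau)))).
  rewrite /Cdiv Cmult_comm; apply: has_sum_ext => i.
  rewrite /w Rmult_plus_distr_r expiD.
  have -> : tau * (lam i - lam i0) = - (tau * lam i0) + tau * lam i by ring.
  by rewrite expiD /Cdiv; ring.
- by move=> x; apply: half => //; rewrite Cmod_mult Cmod_expi Rmult_1_l.
Qed.

(** After the frequencies of a large finite set have been removed, the function
    differs from the term of [i0] by the small tail only. *)
Lemma coef_le_sup (a : I -> C) (f : R -> C) : (forall i, Cmod (a i) <= g i) ->
  exp_series a f -> (forall x, Cmod (f x) <= M) -> forall i, Cmod (a i) <= M.
Proof.
move=> ag af fM i0; apply: le_epsilon => e e0.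
have [s0 [us0 tl]] := summable_tail sg e0.
pose s1 := [seq i <- s0 | i != i0].
have i0s1 : i0 \notin s1 by rewrite mem_filter eqxx.
have [a' [f' [a'g a'0 a's a'f f'M]]] := kill_frequencies i0s1 ag af fM.
have tl1 : small_outside g (i0 :: s1) e.
  move=> t ut Ht; apply: tl => // i /Ht.
  by rewrite in_cons mem_filter negb_or negb_and negbK => /andP[/negbTE->].
have a'0s : has_sum a' (f' 0).
  by apply: has_sum_ext (a'f 0) => i; rewrite Rmult_0_l expi0 Cmult_1_r.
have us1 : uniq (i0 :: s1) by rewrite /= i0s1 filter_uniq.
have := has_sum_dominated_tail a'g us1 tl1 a'0s.
rewrite big_cons big_seq big1 //.
rewrite Cplus_0_r a'0 => h.
have -> : a i0 = ((a i0 - f' 0%R) + f' 0%R)%C by ring.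
by apply: Rle_trans (Cmod_triangle _ _) _; have := f'M 0; lra.
Qed.

End CoefBound.

(** * Quasi-periodic series *)

Section QPSeries.
Variables (nu : nat) (omega : 'I_nu -> R).
Notation lam n := (dotp n omega).

(** A positive constant with [Rabs (dotp n omega) <= freqC * norm1 n]. *)
Definition freqC : R := 1 + \big[Rplus/0]_j Rabs (omega j).

Lemma freqC_gt0 : 0 < freqC.
Proof.
rewrite /freqC; have : 0 <= \big[Rplus/0]_j Rabs (omega j).
  by apply: rsum_ge0 => j; apply: Rabs_pos.
by lra.
Qed.

Definition qp_deriv (a : zvec nu -> C) : zvec nu -> C :=
  fun n => (Ci * RtoC (lam n) * a n)%C.

Lemma Cmod_Ci : Cmod Ci = 1.
Proof. by rewrite /Cmod /= -[RHS]sqrt_1; congr sqrt; ring. Qed.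

(** Part of the exponential decay pays for the factor [norm1 n]:
    [y exp (- y) <= 1] at [y = (r - r') |n|]. *)
Lemma qp_deriv_bounded r r' A a : r' < r -> 0 <= A -> wbounded A r a ->
  wbounded (freqC / (r - r') * A) r' (qp_deriv a).
Proof.
move=> rr A0 aA n; rewrite /qp_deriv !Cmod_mult Cmod_Ci Cmod_R Rmult_1_l.
have d0 : 0 < r - r' by lra.
apply: Rle_trans (_ : freqC * norm1 n * (A * weight r n) <= _).
  by apply: Rmult_le_compat; [exact: Rabs_pos | exact: Cmod_ge_0
     | exact: dotp_le | exact: aA].
have n0 := norm1_ge0 n; have := freqC_gt0 => W0.
have key : norm1 n * exp (- ((r - r') * norm1 n)) <= / (r - r').
  rewrite exp_Ropp; set y := (r - r') * norm1 n.
  have := exp_ineq1_le y; have := exp_pos y => e0 e1.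
  apply: (Rmult_le_reg_r (exp y * (r - r'))); first by nra.
  have -> : norm1 n * / exp y * (exp y * (r - r')) = (r - r') * norm1 n.
    by field; lra.
  rewrite -/y.
  have -> : / (r - r') * (exp y * (r - r')) = exp y by field; lra.
  by lra.
have -> : weight r n = weight r' n * exp (- ((r - r') * norm1 n)).
  rewrite /weight Rmult_assoc -exp_plus; congr (_ * exp _); ring.
have w0 := weight_ge0 r' n.
have h : 0 <= freqC * A * weight r' n by apply: Rmult_le_pos => //; nra.
by have := Rmult_le_compat_l _ _ _ h key; rewrite /Rdiv; lra.
Qed.

Lemma qp_series_exists r A a : 0 <= r -> 0 <= A -> wbounded A r a ->
  is_qp_series omega a
    (fun x => usum (fun n => a n * expi (x * lam n))%C).
Proof.
move=> r0 A0 aA x; apply: usumP (summable_scal A0 (summable_weight nu r0)) _ => n.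
by rewrite Cmod_mult Cmod_expi Rmult_1_r; apply: aA.
Qed.

Lemma qp_series_sup r : 0 <= r -> exists M, forall A a f, 0 <= A ->
  wbounded A r a -> is_qp_series omega a f -> forall x, Cmod (f x) <= M * A.
Proof.
move=> r0; have [_ [M HM]] := @summable_weight nu r r0; exists M.
move=> A a f A0 aA af x; rewrite Rmult_comm.
apply: (@has_sum_le _ _ (fun n => A * weight r n) _ _ _ _ (af x)).
  by move=> n; rewrite Cmod_mult Cmod_expi Rmult_1_r; apply: aA.
by move=> s us; rewrite rsum_scal; apply: Rmult_le_compat_l => //; apply: HM.
Qed.

(** Termwise differentiation, the differentiated series being dominated at half
    the rate. *)
Lemma qp_series_derive r A a f : 0 < r -> 0 <= A -> wbounded A r a ->
  is_qp_series omega a f -> exists2 f1, forall x, derw (fun=> True) f x (f1 x)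
  & is_qp_series omega (qp_deriv a) f1.
Proof.
move=> r0 A0 aA af; have r2 : r / 2 < r by lra.
have bd := qp_deriv_bounded r2 A0 aA.
have C0 : 0 <= freqC / (r - r / 2) * A.
  apply: Rmult_le_pos => //; left; apply: Rdiv_lt_0_compat; last by lra.
  exact: freqC_gt0.
have r20 : 0 <= r / 2 by lra.
have d_sum := qp_series_exists r20 C0 bd.
exists (fun x => usum (fun n => qp_deriv a n * expi (x * lam n))%C) => // x.
apply: (@derw_has_sum _ _ (fun x n => a n * expi (x * lam n))%C
  (fun x n => qp_deriv a n * expi (x * lam n))%C _ _ _ _ _ _
  (summable_scal C0 (summable_weight nu r20))) => //.
- move=> n s _.
  have -> : (qp_deriv a n * expi (s * lam n) =
    a n * (Ci * RtoC (lam n) * expi (s * lam n)))%C by rewrite /qp_deriv; ring.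
  by apply: derw_scal; apply: derw_expi.
- by move=> n s _; rewrite Cmod_mult Cmod_expi Rmult_1_r; apply: bd.
Qed.

(** * The Korteweg-de Vries equation for the coefficients *)

Definition kdv_rhs (a : zvec nu -> C) (n : zvec nu) : C :=
  (Ci * RtoC (lam n ^ 3) * a n - Ci * RtoC (lam n / 2) * conv a a n)%C.

Lemma qp_series_lin a b f g (z w : C) : is_qp_series omega a f ->
  is_qp_series omega b g ->
  is_qp_series omega (fun n => z * a n + w * b n)%C (fun x => z * f x + w * g x)%C.
Proof.
move=> af bg x.
apply: has_sum_ext (has_sum_plus (has_sum_scal z (af x)) (has_sum_scal w (bg x))).
by move=> n; ring.
Qed.

Lemma qp_series_ext a b f g : (forall n, a n = b n) -> (forall x, f x = g x) ->
  is_qp_series omega a f -> is_qp_series omega b g.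
Proof.
by move=> ab fg af x; rewrite -fg; apply: has_sum_ext (af x) => n; rewrite ab.
Qed.

(** The product [f f'] is obtained without multiplying two different series: it
    is half the derivative of [f^2], whose coefficients are [conv a a]. *)
Lemma qp_series_kdv r A a f : 0 < r -> 0 <= A -> wbounded A r a ->
  is_qp_series omega a f -> exists f1 f2 f3,
  [/\ forall x, derw (fun=> True) f x (f1 x),
      forall x, derw (fun=> True) f1 x (f2 x),
      forall x, derw (fun=> True) f2 x (f3 x)
    & is_qp_series omega (kdv_rhs a) (fun x => - (f3 x + f x * f1 x))%C].
Proof.
move=> r0 A0 aA af.
have pos r1 r2 B : r2 < r1 -> 0 <= B -> 0 <= freqC / (r1 - r2) * B.
  move=> r12 B0; apply: Rmult_le_pos => //; left; apply: Rdiv_lt_0_compat.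
    exact: freqC_gt0.
  by lra.
have [f1 ff1 q1] := qp_series_derive r0 A0 aA af.
have ra : 3 * r / 4 < r by lra.
have b1 := qp_deriv_bounded ra A0 aA.
have rb : r / 2 < 3 * r / 4 by lra.
have b2 := qp_deriv_bounded rb (pos _ _ _ ra A0) b1.
have r1 : 0 < 3 * r / 4 by lra.
have r2 : 0 < r / 2 by lra.
have [f2 ff2 q2] := qp_series_derive r1 (pos _ _ _ ra A0) b1 q1.
have [f3 ff3 q3] := qp_series_derive r2 (pos _ _ _ rb (pos _ _ _ ra A0)) b2 q2.
exists f1, f2, f3; split=> //.
have r0' : 0 <= r by lra.
have sq := qp_series_mult r0' A0 aA aA af af.
have bc := conv_bounded r0' A0 A0 aA aA.
have c0 : 0 <= A * A * @convK nu.
  by have := @convK_gt0 nu => k0; apply: Rmult_le_pos; nra.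
have [h hd hq] := qp_series_derive r0 c0 bc sq.
have hE x : h x = (f1 x * f x + f x * f1 x)%C.
  exact: derw_unique (hd x) (derw_mult (ff1 x) (ff1 x)).
apply: qp_series_ext (qp_series_lin (- (1))%C (- (/ 2))%C q3 hq).
  move=> n; rewrite /kdv_rhs /qp_deriv RtoC_div; last by lra.
  rewrite /= !RtoC_mult; have E : (Ci * Ci = - (1))%C.
    by apply: injective_projections => /=; ring.
  set l := RtoC (lam n); set b := a n; set q := conv a a n.
  have -> : (- (1) * (Ci * l * (Ci * l * (Ci * l * b))) =
     - (Ci * Ci) * Ci * (l * l * l) * b)%C by ring.
  by rewrite E /Cdiv; ring.
move=> x; rewrite hE; have two0 : RtoC 2 <> 0%C by move=> []; lra.
by field.
Qed.

Lemma kdv_rhs_bounded r A : 0 < r -> 0 <= A -> exists2 B, 0 <= B &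
  forall a, wbounded A r a -> wbounded B (r / 4) (kdv_rhs a).
Proof.
move=> r0 A0.
have pos r1 r2 B : r2 < r1 -> 0 <= B -> 0 <= freqC / (r1 - r2) * B.
  move=> r12 B0; apply: Rmult_le_pos => //; left; apply: Rdiv_lt_0_compat.
    exact: freqC_gt0.
  by lra.
have ra : 3 * r / 4 < r by lra.
have rb : r / 2 < 3 * r / 4 by lra.
have rc : r / 4 < r / 2 by lra.
have rd : r / 4 < r by lra.
have c0 : 0 <= A * A * @convK nu.
  by have := @convK_gt0 nu => k0; apply: Rmult_le_pos; nra.
have p1 := pos _ _ _ ra A0; have p2 := pos _ _ _ rb p1.
have p3 := pos _ _ _ rc p2; have p4 := pos _ _ _ rd c0.
have p34 := Rplus_le_le_0_compat _ _ p3 p4; eexists; first exact: p34.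
move=> a aA n; have r0' : 0 <= r by lra.
have b3 := qp_deriv_bounded rc p2 (qp_deriv_bounded rb p1
             (qp_deriv_bounded ra A0 aA)) n.
have b4 := qp_deriv_bounded rd c0 (conv_bounded r0' A0 A0 aA aA) n.
rewrite Rmult_plus_distr_r; move: b3 b4; rewrite /qp_deriv !Cmod_mult.
rewrite /kdv_rhs !Cmod_Ci !Rmult_1_l => b3 b4.
apply: Rle_trans (Cmod_triangle _ _) _; rewrite Cmod_opp !Cmod_mult Cmod_Ci.
apply: Rplus_le_compat.
  apply: Rle_trans b3; rewrite !Cmod_R -RPow_abs; apply: Req_le; ring.
apply: Rle_trans b4; rewrite Rmult_1_l; apply: Rmult_le_compat_r.
  exact: Cmod_ge_0.
rewrite !Cmod_R /Rdiv Rabs_mult (Rabs_pos_eq (/ 2)); last by lra.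
by have := Rabs_pos (lam n); lra.
Qed.

Section Nonresonant.
Hypothesis nonres : forall n : zvec nu, n <> zvec0 nu -> lam n <> 0.

Lemma lam_inj (n m : zvec nu) : n <> m -> lam n <> lam m.
Proof.
move=> nm; rewrite (dotp_zsub omega n m).
have : zsub n m <> zvec0 nu; last by move/nonres; lra.
move=> /ffunP H; apply: nm; apply/ffunP => j; have := H j.
by rewrite !ffunE => /Zminus_eq.
Qed.

Lemma qp_coef_le_sup r A a f M : 0 <= r -> 0 <= A -> wbounded A r a ->
  is_qp_series omega a f -> (forall x, Cmod (f x) <= M) ->
  forall n, Cmod (a n) <= M.
Proof.
move=> r0 A0 aA; apply: (@coef_le_sup _ (fun n => lam n)
  (fun n => A * weight r n)) => //; first exact: lam_inj.
exact: (summable_scal A0 (summable_weight nu r0)).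
Qed.

End Nonresonant.
End QPSeries.

(** * The evolution of the coefficients in the interaction picture *)

Lemma half_pow_gt0 k : 0 < (/ 2) ^ k.
Proof. by apply: pow_lt; lra. Qed.

Lemma half_pow_small eps : 0 < eps -> exists k, (/ 2) ^ k < eps.
Proof.
move=> e0; have [|k Hk] := pow_lt_1_zero (/ 2) _ eps e0.
  by rewrite Rabs_pos_eq; lra.
by exists k; have := Hk k (le_n k); have := half_pow_gt0 k => h;
   rewrite Rabs_pos_eq; lra.
Qed.

Lemma le_half_pow x y K : (forall k, x <= y + K * (/ 2) ^ k) -> x <= y.
Proof.
move=> H; apply: le_epsilon => e e0.
have K0 : 0 < Rabs K + 1 by have := Rabs_pos K; lra.
have [k hk] := half_pow_small (Rdiv_lt_0_compat _ _ e0 K0).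
apply: Rle_trans (H k) _; apply: Rplus_le_compat_l.
have h0 := half_pow_gt0 k.
apply: Rle_trans (_ : (Rabs K + 1) * (/ 2) ^ k <= _).
  by apply: Rmult_le_compat_r; [lra | have := Rle_abs K; lra].
have := Rmult_lt_compat_l _ _ _ K0 hk.
have -> : (Rabs K + 1) * (e / (Rabs K + 1)) = e by field; lra.
by lra.
Qed.

(** The intervals around [x k] of radius [2 K / 2^k] are nested. *)
Lemma geometric_limit_R (x : nat -> R) K :
  (forall k, Rabs (x k.+1 - x k) <= K * (/ 2) ^ k) ->
  exists l, forall k, Rabs (x k - l) <= 2 * K * (/ 2) ^ k.
Proof.
move=> H; pose lo k := x k - 2 * K * (/ 2) ^ k; pose hi k := x k + 2 * K * (/ 2) ^ k.
have step k : lo k <= lo k.+1 /\ hi k.+1 <= hi k.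
  have [h1 h2] := proj1 (Rabs_le_between _ _) (H k).
  by rewrite /lo /hi /=; lra.
have K0 : 0 <= K by have := H 0%nat; have := Rabs_pos (x 1%nat - x 0%nat); rewrite /=; lra.
have lohi k : lo k <= hi k by rewrite /lo /hi; have := half_pow_gt0 k; nra.
have mono j k : lo k <= lo (addn k j) /\ hi (addn k j) <= hi k.
  elim: j => [|j [IH1 IH2]]; first by rewrite addn0; lra.
  by rewrite addnS; have := step (addn k j); lra.
have cross j k : lo j <= hi k.
  have := mono k j; have := mono j k; have := lohi (addn j k).
  by rewrite (addnC k j); lra.
have [||l [ub lub]] := completeness (fun r => exists k, r = lo k).
- by exists (hi 0%nat) => r [k ->].
- by exists (lo 0%nat); exists 0%nat.
exists l => k; have h1 : lo k <= l by apply: ub; exists k.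
have h2 : l <= hi k by apply: lub => r [j ->].
by apply/Rabs_le_between; move: h1 h2; rewrite /lo /hi; lra.
Qed.

Lemma geometric_limit (z : nat -> C) K :
  (forall k, Cmod (z k.+1 - z k) <= K * (/ 2) ^ k) ->
  exists l, forall k, Cmod (z k - l) <= 4 * K * (/ 2) ^ k.
Proof.
move=> H.
have [|l1 H1] := @geometric_limit_R (fun k => (z k).1) K.
  by move=> k; apply: Rle_trans (H k); case: (abs_le_Cmod (z k.+1 - z k)).
have [|l2 H2] := @geometric_limit_R (fun k => (z k).2) K.
  by move=> k; apply: Rle_trans (H k); case: (abs_le_Cmod (z k.+1 - z k)).
exists (l1, l2) => k; apply: Rle_trans (Cmod_le_abs _) _.
by have := H1 k; have := H2 k; rewrite /= /Rminus; lra.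
Qed.

Section Evolution.
Variables (nu : nat) (omega : 'I_nu -> R).
Notation lam n := (dotp n omega).
Notation K := (@convK nu).
Notation Om := (freqC omega).

(** The coefficients of the solution of the linear equation [u_t + u_xxx = 0]
    that starts from the series with coefficients [a]. *)
Definition twist t (a : zvec nu -> C) : zvec nu -> C :=
  fun n => (expi (t * lam n ^ 3) * a n)%C.

(** The right-hand side of the system for [a], when the coefficients
    [twist t a] follow [kdv_rhs]; see [twist_derw] and [untwist_derw]. *)
Definition inter_rhs t (a : zvec nu -> C) (n : zvec nu) : C :=
  (- (Ci * RtoC (lam n / 2)) * expi (- (t * lam n ^ 3))
   * conv (twist t a) (twist t a) n)%C.

Lemma twist_wbounded A r t a : wbounded A r a -> wbounded A r (twist t a).
Proof. by move=> aA n; rewrite Cmod_mult Cmod_expi Rmult_1_l. Qed.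

Lemma twistK t a n : twist t (twist (- t) a) n = a n.
Proof.
rewrite /twist -[RHS]Cmult_1_l Cmult_assoc -expiD; congr Cmult.
by rewrite -expi0; congr expi; ring.
Qed.

Lemma inter_factor_le t n z N : Cmod z <= N ->
  Cmod (- (Ci * RtoC (lam n / 2)) * expi (- (t * lam n ^ 3)) * z)%C
  <= Om / 2 * norm1 n * N.
Proof.
move=> zN; rewrite !Cmod_mult Cmod_opp Cmod_mult Cmod_Ci Cmod_expi Cmod_R.
have := dotp_le omega n; rewrite -/Om => h.
apply: Rmult_le_compat => //.
- by rewrite Rmult_1_l Rmult_1_r; apply: Rabs_pos.
- exact: Cmod_ge_0.
by rewrite /Rdiv Rabs_mult (Rabs_pos_eq (/ 2)); lra.
Qed.

Lemma inter_rhs_le A r t a n : 0 <= r -> 0 <= A -> wbounded A r a ->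
  Cmod (inter_rhs t a n) <= Om / 2 * norm1 n * (A * A * K * weight r n).
Proof.
move=> r0 A0 /(@twist_wbounded _ _ t) aA; apply: inter_factor_le.
exact: conv_bounded.
Qed.

Lemma inter_rhs_diff_le A r d t a b n : 0 <= r -> 0 <= A -> 0 <= d ->
  wbounded A r a -> wbounded A r b -> wbounded d r (fun n => a n - b n)%C ->
  Cmod (inter_rhs t a n - inter_rhs t b n) <=
  Om / 2 * norm1 n * (2 * A * d * K * weight r n).
Proof.
move=> r0 A0 d0 /(@twist_wbounded _ _ t) aA /(@twist_wbounded _ _ t) bA abd.
have {}abd : wbounded d r (fun n => twist t a n - twist t b n)%C.
  move=> m; have -> : (twist t a m - twist t b m =
    twist t (fun n => a n - b n) m)%C by rewrite /twist; ring.
  exact: twist_wbounded.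
apply: Rle_trans (inter_factor_le t n (conv_diff r0 A0 d0 aA bA abd n)).
by apply: Req_le; congr Cmod; rewrite /inter_rhs; ring.
Qed.

(** The majorant of [f'] is a constant multiple of the time derivative of the
    weight, so that the mean value inequality returns the weight without
    the factor [norm1 n]. *)
Lemma weighted_gain (D : R -> Prop) (f f' : R -> C) (n : zvec nu) r g B t :
  0 < g -> 0 <= B -> 0 <= t -> (forall s, 0 <= s <= t -> D s) ->
  (forall s, 0 <= s <= t -> derw D f s (f' s)) ->
  (forall s, 0 <= s <= t ->
     Cmod (f' s) <= Om / 2 * norm1 n * (B * weight (r - g * s) n)) ->
  Cmod (f t - f 0%R) <= Om * B / (2 * g) * weight (r - g * t) n.
Proof.
move=> g0 B0 t0 Dt Hf Hb.
pose phi s := Om * B / (2 * g) * weight (r - g * s) n.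
have phi0 s : 0 <= phi s.
  apply: Rmult_le_pos (weight_ge0 _ _).
  have := freqC_gt0 omega => W0.
  by apply: Rdiv_le_0_compat; [apply: Rmult_le_pos; lra | lra].
apply: Rle_trans (_ : phi t - phi 0 <= _); last by have := phi0 0; rewrite /phi; lra.
apply: (@mean_value_ineq D f f' phi
  (fun s => Om / 2 * norm1 n * (B * weight (r - g * s) n))) => // s _.
rewrite /phi /weight; auto_derive => //; rewrite -/(Rminus r (g * s)).
by field; lra.
Qed.

(** The distance between [a] and [b], measured with shrinking weights, is at
    most half of itself by [weighted_gain], hence at most [2 A / 2^k] for all
    [k].  The interval ends at the latest when the rate [r - g t] vanishes. *)
Lemma inter_unique (a b : R -> zvec nu -> C) A r T :
  0 < A -> 0 < r -> 0 < T ->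
  (forall t, 0 <= t < T -> wbounded A r (a t)) ->
  (forall t, 0 <= t < T -> wbounded A r (b t)) ->
  (forall t n, 0 <= t < T -> derw (fun s => 0 <= s < T) (fun s => a s n) t
     (inter_rhs t (a t) n)) ->
  (forall t n, 0 <= t < T -> derw (fun s => 0 <= s < T) (fun s => b s n) t
     (inter_rhs t (b t) n)) ->
  (forall n, a 0 n = b 0 n) ->
  exists t1, 0 < t1 <= T /\ forall t n, 0 <= t < t1 -> a t n = b t n.
Proof.
move=> A0 r0 T0 aA bA da db ab0.
have W0 := freqC_gt0 omega; have K0 := @convK_gt0 nu.
have WAK : 0 < Om * A * K by apply: Rmult_lt_0_compat => //; nra.
pose g := 2 * (Om * A * K); have g0 : 0 < g by rewrite /g; lra.
have rg : 0 < r / g by apply: Rdiv_lt_0_compat.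
pose t1 := Rmin T (r / g).
have t1T : t1 <= T := Rmin_l _ _; have t1r : t1 <= r / g := Rmin_r _ _.
have t10 : 0 < t1 by apply: Rmin_pos.
have gr s : 0 <= s < t1 -> 0 <= r - g * s <= r.
  move=> s1; have : g * s <= g * (r / g) by apply: Rmult_le_compat_l; lra.
  have -> : g * (r / g) = r by field; lra.
  by have : 0 <= g * s by [apply: Rmult_le_pos; lra]; lra.
have low (c : R -> zvec nu -> C) s : (forall t, 0 <= t < T -> wbounded A r (c t)) ->
    0 <= s < t1 -> wbounded A (r - g * s) (c s).
  move=> cA s1 n; apply: Rle_trans (_ : A * weight r n <= _); first by apply: cA; lra.
  by apply: Rmult_le_compat_l; [lra | apply: weight_decr; have := gr s s1; lra].
have iter k t : 0 <= t < t1 ->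
    wbounded (2 * A * (/ 2) ^ k) (r - g * t) (fun n => a t n - b t n)%C.
  elim: k t => [|k IH] t tt1 n.
    rewrite /= Rmult_1_r; apply: Rle_trans (Cmod_triangle _ _) _.
    by rewrite Cmod_opp; have := low a t aA tt1 n; have := low b t bA tt1 n; lra.
  have hk : 0 <= 2 * A * (/ 2) ^ k.
    by apply: Rmult_le_pos; [lra | left; apply: half_pow_gt0].
  have hB : 0 <= 2 * A * (2 * A * (/ 2) ^ k) * K.
    by apply: Rmult_le_pos; [apply: Rmult_le_pos => //; lra | lra].
  have sub s : 0 <= s <= t -> 0 <= s < T by lra.
  have := @weighted_gain (fun s => 0 <= s < T) (fun s => a s n - b s n)%C
    (fun s => inter_rhs s (a s) n - inter_rhs s (b s) n)%C n r g _ t g0 hB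
    (proj1 tt1) sub _ _.
  rewrite ab0; have -> : (a t n - b t n - (b 0%R n - b 0%R n) = a t n - b t n)%C.
    by ring.
  have -> : Om * (2 * A * (2 * A * (/ 2) ^ k) * K) / (2 * g) = 2 * A * (/ 2) ^ k.+1.
    by rewrite /g /=; field; lra.
  apply=> s st; first by apply: derw_minus; [apply: da | apply: db]; apply: sub.
  have st1 : 0 <= s < t1 by lra.
  apply: inter_rhs_diff_le => //; [by case: (gr s st1) | lra | | | exact: IH].
    exact: low aA st1.
  exact: low bA st1.
exists t1; split=> // t n tt1.
apply: Cmod_sub_le0.
apply: (@le_half_pow _ _ (2 * A * weight (r - g * t) n)) => k.
by have := iter k t tt1 n; lra.
Qed.

(** * Local existence by Picard iteration *)

Lemma cont_C_expi x : cont_C (fun t => expi (t * x)).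
Proof.
move=> t eps e0; have [d Hd] := derw_tends (derw_expi (fun=> True) x t) e0.
by exists d => s sd; apply: Hd.
Qed.

Section Picard.
Variables (c : zvec nu -> C) (A r g T : R).
Hypotheses (A0 : 0 < A) (g0 : 0 < g) (T0 : 0 < T).
Hypotheses (gTr : g * T <= r) (small : 2 * (Om * A * K) <= g).
Hypothesis cA : wbounded (A / 2) r c.

(** Freezing the time outside the interval from [0] to [T] makes the iterates
    continuous on the whole line, so that [Cint] applies to them. *)
Definition clamp t := Rmax 0 (Rmin t T).

Lemma clamp_in t : 0 <= clamp t <= T.
Proof.
rewrite /clamp; have := Rmax_l 0 (Rmin t T); have := Rmin_r t T.
by move=> *; split=> //; apply: Rmax_lub; lra.
Qed.

Lemma clamp_id t : 0 <= t <= T -> clamp t = t.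
Proof. by move=> tT; rewrite /clamp Rmin_left ?Rmax_right; lra. Qed.

Lemma clamp_lip s t : Rabs (clamp s - clamp t) <= Rabs (s - t).
Proof.
rewrite /clamp /Rmax /Rmin.
case: (Rle_dec s T) => ?; case: (Rle_dec t T) => ?;
  by repeat case: Rle_dec => ?; split_Rabs; lra.
Qed.

(** Continuity in time lets the nonlinear term be integrated; the bound is the
    one that the Picard map preserves. *)
Definition good (a : R -> zvec nu -> C) :=
  (forall n, cont_C (fun t => a t n)) /\
  (forall t, wbounded A (r - g * clamp t) (a t)).

Definition picard (a : R -> zvec nu -> C) : R -> zvec nu -> C :=
  fun t n => (c n + Cint (fun s => inter_rhs s (a s) n) (clamp t))%C.

Lemma rate_ge0 t : 0 <= r - g * T /\ r - g * T <= r - g * clamp t <= r.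
Proof. by have := clamp_in t; nra. Qed.

Lemma good_uniform a t : good a -> wbounded A (r - g * T) (a t).
Proof.
move=> [_ aA] n; apply: Rle_trans (aA t n) _; apply: Rmult_le_compat_l; first by lra.
by apply: weight_decr; have := rate_ge0 t; lra.
Qed.

Lemma good_cont a n : good a -> cont_C (fun s => inter_rhs s (a s) n).
Proof.
move=> ga; have r0 : 0 <= r - g * T by have := rate_ge0 0; lra.
have Ale : 0 <= A by lra.
have rb s : wbounded A (r - g * T) (twist s (a s)).
  by apply: twist_wbounded; apply: good_uniform.
have rc m : cont_C (fun s => twist s (a s) m).
  by move=> t; apply: tends_mult; [apply: cont_C_expi | exact: (proj1 ga m t)].
move=> t; apply: tends_mult.
  apply: tends_mult; first exact: tends_const.
  have -> : (fun s => expi (- (s * lam n ^ 3))) = (fun s => expi (s * - lam n ^ 3)).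
    by apply: functional_extensionality => s; congr expi; ring.
  have -> : - (t * lam n ^ 3) = t * - lam n ^ 3 by ring.
  exact: cont_C_expi.
apply: (@conv_tends _ _ _ _ (r - g * T) A) => //.
  exact: filter_forall.
by move=> m; apply: rc.
Qed.

Lemma picard_derw a t n : good a -> 0 <= t < T ->
  derw (fun s => 0 <= s < T) (fun s => picard a s n) t (inter_rhs t (a t) n).
Proof.
move=> ga tT.
have H := derw_plus (derw_const (fun s => 0 <= s < T) (c n) t)
  (Cint_derw (fun s => 0 <= s < T) t (good_cont n ga)).
rewrite Cplus_0_l in H; apply: derw_ext H => // s sT.
by rewrite /picard clamp_id //; lra.
Qed.

Lemma picard_dist_le a t n : good a ->
  Cmod (picard a t n - c n) <=
  Om * (A * A * K) / (2 * g) * weight (r - g * clamp t) n.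
Proof.
move=> ga; have [ct0 ctT] := clamp_in t.
have K0 := @convK_gt0 nu.
have B0 : 0 <= A * A * K by apply: Rmult_le_pos; nra.
have := @weighted_gain (fun=> True) (Cint (fun s => inter_rhs s (a s) n))
  (fun s => inter_rhs s (a s) n) n r g _ (clamp t) g0 B0 ct0 (fun _ _ => Logic.I) _ _.
rewrite Cint0 /picard.
have -> z : (c n + z - c n = z - RtoC 0)%C by ring.
apply=> s st; first by apply: Cint_derw; apply: good_cont.
have E : clamp s = s by apply: clamp_id; lra.
have := rate_ge0 s; rewrite E => rs.
by apply: inter_rhs_le; [lra | lra | have [_ /(_ s)] := ga; rewrite E].
Qed.

(** The datum takes half of the admissible bound, and the nonlinear term, by the
    smallness of [Om * A * K / g], the other half at most. *)
Lemma picard_good a : good a -> good (picard a).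
Proof.
move=> ga; split=> [n t eps e0|t n].
  have [d Hd] := derw_tends (Cint_derw (fun=> True) (clamp t) (good_cont n ga)) e0.
  exists d => s sd.
  rewrite /picard; have -> z z' : (c n + z - (c n + z') = z - z')%C by ring.
  by apply: Hd => //; apply: Rle_lt_trans (clamp_lip s t) sd.
have -> : picard a t n = (c n + (picard a t n - c n))%C by ring.
apply: Rle_trans (Cmod_triangle _ _) _.
have h1 := picard_dist_le t n ga.
have h2 : Cmod (c n) <= A / 2 * weight (r - g * clamp t) n.
  apply: Rle_trans (cA n) _; apply: Rmult_le_compat_l; first by lra.
  by apply: weight_decr; have := rate_ge0 t; lra.
have h3 : Om * (A * A * K) / (2 * g) <= A / 2.
  apply: (Rmult_le_reg_r (2 * g)); first by lra.
  have -> : Om * (A * A * K) / (2 * g) * (2 * g) = A * (Om * A * K) by field; lra.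
  have -> : A / 2 * (2 * g) = A * g by field.
  by apply: Rmult_le_compat_l; lra.
by have := Rmult_le_compat_r _ _ _ (weight_ge0 (r - g * clamp t) n) h3; lra.
Qed.

Lemma picard_contract a b d : good a -> good b -> 0 <= d ->
  (forall t, wbounded d (r - g * clamp t) (fun n => a t n - b t n)%C) ->
  forall t, wbounded (d / 2) (r - g * clamp t)
              (fun n => picard a t n - picard b t n)%C.
Proof.
move=> ga gb d0 abd t n; have [ct0 ctT] := clamp_in t.
have K0 := @convK_gt0 nu.
have B0 : 0 <= 2 * A * d * K by apply: Rmult_le_pos; nra.
have := @weighted_gain (fun=> True)
  (fun s => Cint (fun s => inter_rhs s (a s) n) s -
            Cint (fun s => inter_rhs s (b s) n) s)%C
  (fun s => inter_rhs s (a s) n - inter_rhs s (b s) n)%C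
  n r g _ (clamp t) g0 B0 ct0 (fun _ _ => Logic.I) _ _.
rewrite !Cint0 /picard.
have -> z z' : (c n + z - (c n + z') = z - z' - (RtoC 0 - RtoC 0))%C by ring.
move=> H; apply: Rle_trans (H _ _) _ => [s st|s st|].
- by apply: derw_minus; apply: Cint_derw; apply: good_cont.
- have E : clamp s = s by apply: clamp_id; lra.
  have := rate_ge0 s; rewrite E => rs.
  apply: inter_rhs_diff_le; [lra | lra | lra | | | ].
  + by have [_ /(_ s)] := ga; rewrite E.
  + by have [_ /(_ s)] := gb; rewrite E.
  + by have := abd s; rewrite E.
apply: Rmult_le_compat_r; first exact: weight_ge0.
apply: (Rmult_le_reg_r (2 * g)); first by lra.
have -> : Om * (2 * A * d * K) / (2 * g) * (2 * g) = d * (2 * (Om * A * K)).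
  by field; lra.
have -> : d / 2 * (2 * g) = d * g by field.
exact: Rmult_le_compat_l.
Qed.

Definition picard_iter k := ssrnat.iter k picard (fun=> c).

Lemma good_iter k : good (picard_iter k).
Proof.
elim: k => [|k IH]; last exact: picard_good.
split=> [n|t n]; first by move=> ?; apply: tends_const.
apply: Rle_trans (cA n) _; apply: Rmult_le_compat; [lra | exact: weight_ge0 | lra | ].
by apply: weight_decr; have := rate_ge0 t; lra.
Qed.

Lemma picard_iter_step k t : wbounded (2 * A * (/ 2) ^ k) (r - g * clamp t)
  (fun n => picard_iter k.+1 t n - picard_iter k t n)%C.
Proof.
elim: k t => [|k IH] t.
  move=> n; rewrite /= Rmult_1_r; apply: Rle_trans (Cmod_triangle _ _) _.
  have [_ /(_ t n)] := good_iter 0; have [_ /(_ t n)] := good_iter 1.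
  by rewrite Cmod_opp /=; lra.
have -> : 2 * A * (/ 2) ^ k.+1 = 2 * A * (/ 2) ^ k / 2 by rewrite /=; field.
have p0 : 0 <= 2 * A * (/ 2) ^ k by have := half_pow_gt0 k; nra.
exact: (picard_contract (good_iter k.+1) (good_iter k) p0 IH).
Qed.

(** The limit of the iterates is a fixed point because its image is as close to
    the next iterate as the contraction allows; no limit has to be taken under
    the integral. *)
Lemma picard_fixpoint : exists a, good a /\ forall t n, a t n = picard a t n.
Proof.
have lim t n : exists l, forall k, Cmod (picard_iter k t n - l) <=
    8 * A * (/ 2) ^ k * weight (r - g * clamp t) n.
  have [|l Hl] := @geometric_limit (fun k => picard_iter k t n)
    (2 * A * weight (r - g * clamp t) n).
    by move=> k; have := picard_iter_step k t n; lra.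
  by exists l => k; have := Hl k; lra.
pose a t n := epsilon (inhabits (RtoC 0)) (fun l => forall k,
  Cmod (picard_iter k t n - l) <= 8 * A * (/ 2) ^ k * weight (r - g * clamp t) n).
have aP k t : wbounded (8 * A * (/ 2) ^ k) (r - g * clamp t)
    (fun n => picard_iter k t n - a t n)%C.
  by move=> n; have := epsilon_spec (inhabits (RtoC 0)) _ (lim t n); apply.
have ga : good a.
  split=> [n t eps e0|t n]; last first.
    apply: (@le_half_pow _ _ (8 * A * weight (r - g * clamp t) n)) => k.
    have -> : a t n = (picard_iter k t n - (picard_iter k t n - a t n))%C by ring.
    apply: Rle_trans (Cmod_triangle _ _) _; rewrite Cmod_opp.
    by have := aP k t n; have [_ /(_ t n)] := good_iter k; lra.
  pose w := 8 * A * (weight (r - g * T) n + 1).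
  have w0 := weight_ge0 (r - g * T) n.
  have w1 : 0 < w by rewrite /w; apply: Rmult_lt_0_compat; lra.
  have ew : 0 < eps / 3 / w by apply: Rdiv_lt_0_compat; lra.
  have [k hk] := half_pow_small ew.
  have close s : Cmod (picard_iter k s n - a s n) <= eps / 3.
    apply: Rle_trans (aP k s n) _.
    have h : weight (r - g * clamp s) n <= weight (r - g * T) n + 1.
      apply: Rle_trans (_ : weight (r - g * T) n <= _); last by lra.
      by apply: weight_decr; have := rate_ge0 s; lra.
    have -> : eps / 3 = 8 * A * (eps / 3 / w) * (weight (r - g * T) n + 1).
      by rewrite /w; field; lra.
    have p0 := half_pow_gt0 k.
    apply: Rmult_le_compat => //; [nra | exact: weight_ge0 | ].
    by apply: Rmult_le_compat_l; lra.
  have e3 : 0 < eps / 3 by lra.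
  apply: filter_imp ((proj1 (good_iter k)) n t _ e3) => s Hs.
  have hs := close s; have ht := close t.
  set x := picard_iter k s n in Hs hs; set y := picard_iter k t n in Hs ht.
  have -> : (a s n - a t n = (x - y) - (x - a s n) + (y - a t n))%C by ring.
  apply: Rle_trans (Cmod_triangle _ _) _.
  have := Cmod_triangle (x - y)%C (- (x - a s n))%C.
  by rewrite Cmod_opp -/(Cminus (x - y) (x - a s n)); lra.
exists a; split=> // t n.
apply: Cmod_sub_le0; apply: (@le_half_pow _ _ (8 * A * weight (r - g * clamp t) n)) => k.
have p0 : 0 <= 8 * A * (/ 2) ^ k by have := half_pow_gt0 k; nra.
have h1 := picard_contract (good_iter k) ga p0 (aP k) t n.
have h2 := aP k.+1 t n; rewrite /= -/(picard_iter k) in h2.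
set y := picard (picard_iter k) t n in h1 h2.
have -> : (a t n - picard a t n = (y - picard a t n) - (y - a t n))%C by ring.
apply: Rle_trans (Cmod_triangle _ _) _; rewrite Cmod_opp; lra.
Qed.

Lemma inter_exists : exists a : R -> zvec nu -> C,
  [/\ forall t, 0 <= t < T -> wbounded A (r - g * t) (a t),
      forall n, a 0 n = c n,
      forall t n, 0 <= t < T ->
        Cmod (a t n - c n) <= Om * (A * A * K) / (2 * g) * weight (r - g * t) n
    & forall t n, 0 <= t < T -> derw (fun s => 0 <= s < T) (fun s => a s n) t
        (inter_rhs t (a t) n)].
Proof.
have [a [ga aE]] := picard_fixpoint; exists a.
have id t : 0 <= t < T -> clamp t = t by move=> tT; apply: clamp_id; lra.
split=> [t tT|n|t n tT|t n tT].
- by have [_ /(_ t)] := ga; rewrite id.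
- by rewrite aE /picard id ?Cint0 ?Cplus_0_r //; lra.
- by rewrite aE; have := picard_dist_le t n ga; rewrite id.
by apply: derw_ext (picard_derw n ga tT).
Qed.

End Picard.
End Evolution.

(** * Solutions and their coefficients *)

Section Solutions.
Variables (nu : nat) (omega : 'I_nu -> R).
Notation lam n := (dotp n omega).
Notation K := (@convK nu).
Notation Om := (freqC omega).

Lemma expi_inv_mult x z : (expi x * (expi (- x) * z) = z)%C.
Proof. by rewrite Cmult_assoc (Cmult_comm (expi x)) expiN Cmult_1_l. Qed.

Lemma twist_derw (D : R -> Prop) (a : R -> zvec nu -> C) t n :
  derw D (fun s => a s n) t (inter_rhs omega t (a t) n) ->
  derw D (fun s => twist omega s (a s) n) t (kdv_rhs omega (twist omega t (a t)) n).
Proof.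
move=> /(derw_mult (derw_expi D (lam n ^ 3) t)).
congr derw; rewrite /inter_rhs /kdv_rhs; set q := conv _ _ n; rewrite /twist.
set l := (Ci * RtoC (lam n / 2))%C; set x := t * _.
have -> : (expi x * (- l * expi (- x) * q) = - l * (expi x * (expi (- x) * q)))%C.
  by ring.
by rewrite expi_inv_mult; ring.
Qed.

Lemma untwist_derw (D : R -> Prop) (h : R -> zvec nu -> C) t n :
  derw D (fun s => h s n) t (kdv_rhs omega (h t) n) ->
  derw D (fun s => twist omega (- s) (h s) n) t
    (inter_rhs omega t (twist omega (- t) (h t)) n).
Proof.
move=> /(derw_mult (derw_expi D (- lam n ^ 3) t)) H.
have E s : s * - lam n ^ 3 = - s * lam n ^ 3 by ring.
have -> : inter_rhs omega t (twist omega (- t) (h t)) n =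
  (Ci * RtoC (- lam n ^ 3) * expi (t * - lam n ^ 3) * h t n +
   expi (t * - lam n ^ 3) * kdv_rhs omega (h t) n)%C.
  rewrite /inter_rhs /kdv_rhs.
  have -> : twist omega t (twist omega (- t) (h t)) = h t.
    by apply: functional_extensionality => m; rewrite twistK.
  rewrite RtoC_opp E -Ropp_mult_distr_l; ring.
have {}H := H; move: H; congr derw.
by apply: functional_extensionality => s; rewrite /twist E.
Qed.

Lemma kdv_rhs_tends (D : R -> Prop) (h : R -> zvec nu -> C) A r t :
  0 <= A -> 0 <= r -> D t -> (forall s, D s -> wbounded A r (h s)) ->
  (forall m, tends (within D (locally t)) (fun s => h s m) (h t m)) ->
  forall n, tends (within D (locally t))
    (fun s => kdv_rhs omega (h s) n) (kdv_rhs omega (h t) n).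
Proof.
move=> A0 r0 Dt hA hc n.
apply: tends_plus.
  by apply: tends_mult => //; apply: tends_const.
have -> : (- (Ci * RtoC (lam n / 2) * conv (h t) (h t) n) =
           - (Ci * RtoC (lam n / 2)) * conv (h t) (h t) n)%C by ring.
have -> : (fun s => - (Ci * RtoC (lam n / 2) * conv (h s) (h s) n))%C =
          (fun s => - (Ci * RtoC (lam n / 2)) * conv (h s) (h s) n)%C.
  by apply: functional_extensionality => s; ring.
apply: tends_mult; first exact: tends_const.
apply: (@conv_tends _ _ _ _ r A) => //; last exact: hA.
by exists (mkposreal _ Rlt_0_1) => s _; apply: hA.
Qed.

(** As the solution is differentiable in time only pointwise in [x], the
    difference quotients of the coefficients are compared with those of the
    solution through [qp_coef_le_sup]; this needs the time derivative to be
    continuous uniformly in [x], which follows in turn from the Lipschitz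
    continuity of the coefficients. *)
Lemma coef_kdv T A r (h : R -> zvec nu -> C) (v : R -> R -> C) :
  (forall n : zvec nu, n <> zvec0 nu -> lam n <> 0) -> 0 <= A -> 0 < r ->
  (forall t, 0 <= t < T -> wbounded A r (h t)) ->
  (forall t, 0 <= t < T -> is_qp_series omega (h t) (v t)) ->
  solves_KdV T v -> forall t n, 0 <= t < T ->
  derw (fun s => 0 <= s < T) (fun s => h s n) t (kdv_rhs omega (h t) n).
Proof.
move=> nonres A0 r0 hA hv [vt [vx [vxx [vxxx V]]]].
pose D s := 0 <= s < T.
have Dconv a b s : D a -> D b -> a <= s <= b -> D s by rewrite /D; lra.
have vt_series t : D t -> is_qp_series omega (kdv_rhs omega (h t)) (vt t).
  move=> Dt; have [f1 [f2 [f3 [d1 d2 d3 q]]]] :=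
    qp_series_kdv r0 A0 (hA t Dt) (hv t Dt).
  have E1 : vx t = f1.
    apply: functional_extensionality => x; have [_ [/is_derive_derw Hx _]] := V t x Dt.
    exact: derw_unique Hx (d1 x).
  have E2 : vxx t = f2.
    apply: functional_extensionality => x.
    have [_ [_ [/is_derive_derw Hx _]]] := V t x Dt; rewrite E1 in Hx.
    exact: derw_unique Hx (d2 x).
  apply: qp_series_ext q => // x.
  have [_ [_ [_ [/is_derive_derw Hx E]]]] := V t x Dt.
  rewrite E2 in Hx; have E3 := derw_unique Hx (d3 x).
  rewrite -E3 -E1.
  have -> : (vt t x = (vt t x + vxxx t x + v t x * vx t x)
                      - (vxxx t x + v t x * vx t x))%C by ring.
  by rewrite E; ring.
have vt_der x t : D t -> derw D (fun s => v s x) t (vt t x).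
  by move=> Dt; have [/is_derive_withinE H _] := V t x Dt; apply: H.
have [B B0 rhsB] := kdv_rhs_bounded omega r0 A0.
have r4 : 0 <= r / 4 by lra.
have r0' : 0 <= r by lra.
have [M HM] := qp_series_sup omega r4.
have vtL t x : D t -> Cmod (vt t x) <= M * B.
  by move=> Dt; apply: (HM _ _ _ B0 (rhsB _ (hA t Dt)) (vt_series t Dt)).
(* The time derivative is bounded, so [v], and with it each coefficient, is
   Lipschitz in time. *)
have hL s t n : D s -> D t -> Cmod (h s n - h t n) <= M * B * Rabs (s - t).
  move=> Ds Dt; have A2 : 0 <= 2 * A by lra.
  apply: (@qp_coef_le_sup _ _ nonres r (2 * A) (fun n => h s n - h t n)%C
    (fun x => v s x - v t x)%C _ r0' A2).
  - move=> m; apply: Rle_trans (Cmod_triangle _ _) _.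
    by rewrite Cmod_opp; have := hA s Ds m; have := hA t Dt m; lra.
  - move=> x; apply: has_sum_ext (has_sum_minus (hv s Ds x) (hv t Dt x)) => m.
    by ring.
  - move=> x; apply: (mean_value_lipschitz Dconv (fun s Ds => vt_der x s Ds)) => //.
    by move=> s' Ds'; apply: vtL.
move=> t n Dt eps e0.
have h_tends m : tends (within D (locally t)) (fun s => h s m) (h t m).
  move=> e e00; have M0 : 0 < Rabs (M * B) + 1 by have := Rabs_pos (M * B); lra.
  have e1 : 0 < e / (Rabs (M * B) + 1) by apply: Rdiv_lt_0_compat.
  exists (mkposreal _ e1) => s /= sd Ds; apply: Rle_trans (hL s t m Ds Dt) _.
  have {}sd : Rabs (s - t) < e / (Rabs (M * B) + 1) by exact: sd.
  have -> : e = (Rabs (M * B) + 1) * (e / (Rabs (M * B) + 1)) by field; lra.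
  apply: Rle_trans (_ : (Rabs (M * B) + 1) * Rabs (s - t) <= _).
    apply: Rmult_le_compat_r; first exact: Rabs_pos.
    by have := Rle_abs (M * B); lra.
  by apply: Rmult_le_compat_l; lra.
have g_tends m := kdv_rhs_tends A0 r0' Dt hA h_tends m.
(* The time derivative is continuous in [t] uniformly in [x]: the moduli of
   the coefficient differences are summed by dominated convergence. *)
have [d Hd] : within D (locally t) (fun s => forall x, Cmod (vt s x - vt t x) <= eps).
  pose z s m := (kdv_rhs omega (h s) m - kdv_rhs omega (h t) m)%C.
  have zB s m : D s -> Cmod (z s m) <= 2 * B * weight (r / 4) m.
    move=> Ds; apply: Rle_trans (Cmod_triangle _ _) _; rewrite Cmod_opp.
    by have := rhsB _ (hA s Ds) m; have := rhsB _ (hA t Dt) m; lra.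
  have B2 : 0 <= 2 * B by lra.
  have sw := summable_scal B2 (summable_weight nu r4).
  have absB s m : D s -> Cmod (RtoC (Cmod (z s m))) <= 2 * B * weight (r / 4) m.
    by move=> Ds; rewrite Cmod_R Rabs_pos_eq; [apply: zB | apply: Cmod_ge_0].
  have S_tends := @has_sum_dominated_convergence _ R (within D (locally t)) _
    (fun s m => RtoC (Cmod (z s m))) (fun s => usum (fun m => RtoC (Cmod (z s m))))
    (fun=> RtoC 0) (RtoC 0) _ sw _ _ _ _ _.
  have {}S_tends : tends (within D (locally t))
      (fun s => usum (fun m => RtoC (Cmod (z s m)))) (RtoC 0).
    apply: S_tends.
    - by exists (mkposreal _ Rlt_0_1) => s _ Ds m; apply: absB.
    - by move=> m; rewrite Cmod_0; case: sw.
    - move=> m e e00; apply: filter_imp (g_tends m e e00) => s.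
      by rewrite -/(z s m) Cminus0 Cmod_R Rabs_pos_eq //; apply: Cmod_ge_0.
    - by exists (mkposreal _ Rlt_0_1) => s _ Ds; apply: usumP sw (fun m => absB s m Ds).
    - by have := has_sum_scal (RtoC 0) (hv t Dt 0); rewrite Cmult_0_l;
        apply: has_sum_ext => m; ring.
  have [d Hd] := S_tends eps e0; exists d => s sd Ds x.
  have := Hd s sd Ds; rewrite Cminus0; apply: Rle_trans.
  apply: (@has_sum_le _ (fun m => z s m * expi (x * lam m))%C
    (fun m => Cmod (z s m))).
  - by move=> m; rewrite Cmod_mult Cmod_expi; lra.
  - apply: has_sum_nonneg_sum_le => [m|]; first exact: Cmod_ge_0.
    by apply: usumP sw (fun m => absB s m Ds).
  - apply: has_sum_ext (has_sum_minus (vt_series s Ds x) (vt_series t Dt x)).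
    by move=> m; rewrite /z; ring.
exists d => s sd Ds.
have sum0 : 0 <= 2 * A + Rabs (s - t) * B.
  by have := Rabs_pos (s - t); have := Rmult_le_pos _ _ (Rabs_pos (s - t)) B0; lra.
apply: (@qp_coef_le_sup _ _ nonres (r / 4) (2 * A + Rabs (s - t) * B)
  (fun n => h s n - h t n - RtoC (s - t) * kdv_rhs omega (h t) n)%C
  (fun x => v s x - v t x - RtoC (s - t) * vt t x)%C _ r4 sum0).
- move=> m; apply: Rle_trans (Cmod_triangle _ _) _.
  have t1 := Cmod_triangle (h s m) (- h t m); rewrite Cmod_opp in t1.
  rewrite Cmod_opp Cmod_mult Cmod_R.
  have w1 : A * weight r m <= A * weight (r / 4) m.
    by apply: Rmult_le_compat_l => //; apply: weight_decr; lra.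
  have := hA s Ds m; have := hA t Dt m.
  have := Rmult_le_compat_l _ _ _ (Rabs_pos (s - t)) (rhsB _ (hA t Dt) m).
  by rewrite -/(Cminus (h s m) (h t m)) in t1 *; lra.
- move=> x; apply: has_sum_ext (has_sum_minus
    (has_sum_minus (hv s Ds x) (hv t Dt x))
    (has_sum_scal (RtoC (s - t)) (vt_series t Dt x))) => m.
  by ring.
(* The mean value inequality for [v y x - y * vt t x] near [y = t]. *)
move=> x; pose D' s := D s /\ ball t d s.
have D'conv a b y : D' a -> D' b -> a <= y <= b -> D' y.
  move=> [Da ta] [Db tb] yab; split; first exact: Dconv yab.
  have {}ta : Rabs (a - t) < d by exact: ta.
  have {}tb : Rabs (b - t) < d by exact: tb.
  suff : Rabs (y - t) < d by [].
  by move: ta tb => /Rabs_def2 ta /Rabs_def2 tb; apply: Rabs_def1; lra.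
have D't : D' t by split=> //; apply: ball_center.
have := @mean_value_lipschitz D' (fun y => v y x - (RtoC y * vt t x))%C
  (fun y => vt y x - vt t x)%C eps D'conv _ _ s t (conj Ds sd) D't.
have -> : (v s x - RtoC s * vt t x - (v t x - RtoC t * vt t x) =
  v s x - v t x - RtoC (s - t) * vt t x)%C by rewrite RtoC_minus; ring.
apply=> [y [Dy yd]|y [Dy yd]]; last exact: Hd.
apply: derw_minus.
  by apply: derw_sub (vt_der x y Dy) => ? [].
move=> e e00; exists (mkposreal _ Rlt_0_1) => w _ _.
have -> : (RtoC w * vt t x - RtoC y * vt t x - RtoC (w - y) * vt t x = 0)%C.
  by rewrite RtoC_minus; ring.
by rewrite Cmod_0; apply: Rmult_le_pos; [lra | exact: Rabs_pos].
Qed.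

(** The right-hand side of the equation being a series with coefficients
    [kdv_rhs (b t)], it is the termwise derivative of [u] in time. *)
Lemma coef_solves_kdv T A r (b : R -> zvec nu -> C) (u : R -> R -> C) :
  0 <= A -> 0 < r -> (forall t, 0 <= t < T -> wbounded A r (b t)) ->
  (forall t, 0 <= t < T -> is_qp_series omega (b t) (u t)) ->
  (forall t n, 0 <= t < T ->
     derw (fun s => 0 <= s < T) (fun s => b s n) t (kdv_rhs omega (b t) n)) ->
  solves_KdV T u.
Proof.
move=> A0 r0 bA bu db.
(* For each time, the triple of the derivatives in [x]; the choice for all
   times at once turns them into functions of [t] and [x]. *)
pose good_derivs t (p : (R -> C) * (R -> C) * (R -> C)) := 0 <= t < T ->
  [/\ forall x, derw (fun=> True) (u t) x (p.1.1 x),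
      forall x, derw (fun=> True) p.1.1 x (p.1.2 x),
      forall x, derw (fun=> True) p.1.2 x (p.2 x)
    & is_qp_series omega (kdv_rhs omega (b t))
        (fun x => - (p.2 x + u t x * p.1.1 x))%C].
have ex t : exists p, good_derivs t p.
  case: (excluded_middle_informative (0 <= t < T)) => tT.
    have [f1 [f2 [f3 H]]] := qp_series_kdv r0 A0 (bA t tT) (bu t tT).
    by exists (f1, f2, f3).
  by exists (u t, u t, u t) => /tT.
pose p t := proj1_sig (constructive_indefinite_description _ (ex t)).
have pP t : good_derivs t (p t) := proj2_sig (constructive_indefinite_description _ (ex t)).
pose ut t x := (- ((p t).2 x + u t x * (p t).1.1 x))%C.
exists ut, (fun t => (p t).1.1), (fun t => (p t).1.2), (fun t => (p t).2).
move=> t x tT; have [d1 d2 d3 q] := pP t tT.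
split; last first.
  split; first exact/is_derive_derw.
  split; first exact/is_derive_derw.
  split; first exact/is_derive_derw.
  by rewrite /ut; ring.
apply/is_derive_withinE => //.
have [B B0 rhsB] := kdv_rhs_bounded omega r0 A0.
have r4 : 0 <= r / 4 by lra.
have Dconv y z s : 0 <= y < T -> 0 <= z < T -> y <= s <= z -> 0 <= s < T by lra.
apply: (@derw_has_sum _ (fun s => 0 <= s < T)
  (fun s n => b s n * expi (x * dotp n omega))%C
  (fun s n => kdv_rhs omega (b s) n * expi (x * dotp n omega))%C _ _ _ _ Dconv tT
  (summable_scal B0 (summable_weight nu r4))).
- move=> n s sT; have := derw_scal (expi (x * dotp n omega)) (db s n sT).
  rewrite Cmult_comm; congr derw.
  by apply: functional_extensionality => y; rewrite Cmult_comm.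
- move=> n s sT; rewrite Cmod_mult Cmod_expi Rmult_1_r; apply: rhsB; exact: bA.
- by move=> s sT; apply: bu.
exact: q.
Qed.

End Solutions.

Theorem theoremA (nu : nat) (hnu : (1 <= nu)%nat) (omega : 'I_nu -> R)
    (c : zvec nu -> C) (u0 : R -> C) (B0 kappa : R)
    (hB0 : (0 < B0)%R) (hkappa : (0 < kappa)%R)
    (hu0 : is_qp_series omega c u0)
    (hc : forall n : zvec nu, (Cmod (c n) <= B0 * exp (- (kappa * norm1 n)))%R) :
  exists (t0 : R) (ct : R -> zvec nu -> C) (u : R -> R -> C),
    (0 < t0)%R /\
    (forall t : R, (0 <= t < t0)%R -> is_qp_series omega (ct t) (u t)) /\
    (forall (t : R) (n : zvec nu), (0 <= t < t0)%R ->
       (Cmod (ct t n) <= 2 * B0 * exp (- (kappa / 2 * norm1 n)))%R) /\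
    solves_KdV t0 u /\
    (forall x : R, u 0%R x = u0 x) /\
    ((forall n : zvec nu, n <> zvec0 nu -> dotp n omega <> 0%R) ->
     forall (t2 : R) (h : R -> zvec nu -> C) (v : R -> R -> C) (B rho : R),
       (0 < t2)%R -> (0 < B)%R -> (0 < rho)%R ->
       (forall t : R, (0 <= t < t2)%R -> is_qp_series omega (h t) (v t)) ->
       (forall (t : R) (n : zvec nu), (0 <= t < t2)%R ->
          (Cmod (h t n) <= B * exp (- (rho * norm1 n)))%R) ->
       solves_KdV t2 v ->
       (forall x : R, v 0%R x = u0 x) ->
       exists t1 : R, (0 < t1)%R /\ (t1 <= t0)%R /\ (t1 <= t2)%R /\
         forall t x : R, (0 <= t < t1)%R -> v t x = u t x).
Proof.
have W0 := freqC_gt0 omega; have K0 := @convK_gt0 nu.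
have [C1 C10 HC1] := @exp_le_weight nu (3 * kappa / 4) kappa ltac:(lra).
pose A := 2 * B0 * C1.
have A0 : 0 < A by rewrite /A; apply: Rmult_lt_0_compat; lra.
have cA : wbounded (A / 2) (3 * kappa / 4) c.
  move=> n; apply: Rle_trans (hc n) _.
  have -> : A / 2 * weight (3 * kappa / 4) n = B0 * (C1 * weight (3 * kappa / 4) n).
    by rewrite /A; field.
  by apply: Rmult_le_compat_l; [lra | apply: HC1].
have WAK : 0 < freqC omega * A * convK nu.
  by apply: Rmult_lt_0_compat => //; apply: Rmult_lt_0_compat.
(* The first summand makes the Picard map contract; the second one keeps the
   solution within [B0] of the initial datum. *)
pose g := 2 * (freqC omega * A * convK nu) +
          A * (freqC omega * A * convK nu) / (2 * B0).
have g2 : 0 < A * (freqC omega * A * convK nu) / (2 * B0).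
  by apply: Rdiv_lt_0_compat; [apply: Rmult_lt_0_compat | lra].
have small : 2 * (freqC omega * A * convK nu) <= g by rewrite /g; lra.
have g0 : 0 < g by lra.
have drift : freqC omega * (A * A * convK nu) / (2 * g) <= B0.
  apply: (Rmult_le_reg_r (2 * g)); first by lra.
  have -> : freqC omega * (A * A * convK nu) / (2 * g) * (2 * g) =
    A * (freqC omega * A * convK nu) / (2 * B0) * (2 * B0) by field; lra.
  have -> : B0 * (2 * g) = g * (2 * B0) by ring.
  by apply: Rmult_le_compat_r; [lra | rewrite /g; lra].
pose T := kappa / (4 * g).
have T0 : 0 < T by apply: Rdiv_lt_0_compat; lra.
have gT : g * T = kappa / 4 by rewrite /T; field; lra.
have gTr : g * T <= 3 * kappa / 4 by lra.
have [a [aA a0 adrift ad]] := inter_exists A0 g0 T0 gTr small cA.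
pose ct t := twist omega t (a t).
have rate t : 0 <= t < T -> kappa / 2 <= 3 * kappa / 4 - g * t.
  by move=> tT; have := Rmult_le_compat_l g t T ltac:(lra) ltac:(lra); lra.
have k2 : 0 <= kappa / 2 by lra.
have ctA t : 0 <= t < T -> wbounded A (kappa / 2) (ct t).
  move=> tT; apply: twist_wbounded.
  by apply: wbounded_weaken (rate t tT) (aA t tT); lra.
pose u t x := usum (fun n => ct t n * expi (x * dotp n omega))%C.
have uq t : 0 <= t < T -> is_qp_series omega (ct t) (u t).
  by move=> tT; apply: qp_series_exists k2 _ (ctA t tT); lra.
have ctd t n : 0 <= t < T -> derw (fun s => 0 <= s < T) (fun s => ct s n) t
    (kdv_rhs omega (ct t) n).
  by move=> tT; apply: twist_derw; apply: ad.
have ct0 n : ct 0 n = c n.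
  by rewrite /ct /twist Rmult_0_l expi0 a0 Cmult_1_l.
exists T, ct, u; split=> //; split=> //; split.
  move=> t n tT; rewrite /ct Cmod_mult Cmod_expi Rmult_1_l.
  have -> : a t n = (c n + (a t n - c n))%C by ring.
  apply: Rle_trans (Cmod_triangle _ _) _.
  have n0 := norm1_ge0 n.
  have e1 : exp (- (kappa * norm1 n)) <= exp (- (kappa / 2 * norm1 n)).
    by apply: exp_le_exp; nra.
  have e2 : weight (3 * kappa / 4 - g * t) n <= exp (- (kappa / 2 * norm1 n)).
    apply: Rle_trans (weight_le_exp _ _) _.
    by apply: exp_le_exp; have := rate t tT; nra.
  have h1 := hc n; have h2 := adrift t n tT.
  have h3 := Rmult_le_compat_l B0 _ _ ltac:(lra) e1.
  have d0 : 0 <= freqC omega * (A * A * convK nu) / (2 * g).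
    by apply: Rdiv_le_0_compat; [nra | lra].
  have h4 := Rmult_le_compat _ _ _ _ d0 (weight_ge0 _ _) drift e2.
  by lra.
have in0 : 0 <= 0 < T by lra.
split; first by apply: (@coef_solves_kdv _ omega T A (kappa / 2) ct) => //; lra.
split.
  move=> x; apply: has_sum_unique (uq 0 in0 x) _.
  by apply: has_sum_ext (hu0 x) => n; rewrite ct0.
move=> nonres t2 h v B rho t20 B_0 rho0 hv hB vK v0.
(* A rate at which both [h] and [ct] are bounded by the weight, which needs it to
   be strictly below [rho]. *)
pose r := Rmin rho (kappa / 2) / 2.
have rr : r < rho.
  by rewrite /r; have := Rmin_l rho (kappa / 2); lra.
have rk : r <= kappa / 2.
  have := Rmin_r rho (kappa / 2).
  by rewrite /r; have : 0 < Rmin rho (kappa / 2) by [apply: Rmin_pos; lra]; lra.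
have r0 : 0 < r.
  by rewrite /r; have : 0 < Rmin rho (kappa / 2) by [apply: Rmin_pos; lra]; lra.
have [C2 C20 HC2] := @exp_le_weight nu r rho rr.
pose A2 := A + B * C2.
have BC2 : 0 < B * C2 by apply: Rmult_lt_0_compat.
have A20 : 0 < A2 by rewrite /A2; lra.
have hA t : 0 <= t < t2 -> wbounded A2 r (h t).
  move=> tt2 n; apply: Rle_trans (hB t n tt2) _.
  have := Rmult_le_compat_l B _ _ ltac:(lra) (HC2 n).
  by rewrite /A2; have := Rmult_le_pos _ _ (Rlt_le _ _ A0) (weight_ge0 r n); lra.
have aA2 t : 0 <= t < T -> wbounded A2 r (a t).
  move=> tT n; have rt := rate t tT.
  have := aA t tT n; have w1 := @weight_decr nu r (3 * kappa / 4 - g * t) n ltac:(lra).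
  have := Rmult_le_compat_l A _ _ ltac:(lra) w1.
  by rewrite /A2; have := Rmult_le_pos _ _ (Rlt_le _ _ BC2) (weight_ge0 r n); lra.
have h0 n : h 0 n = c n.
  have r0' : 0 <= r by lra.
  have in2 : 0 <= 0 < t2 by lra.
  have A22 : 0 <= 2 * A2 by lra.
  apply: Cmod_sub_le0.
  apply: (@qp_coef_le_sup _ _ nonres r (2 * A2) (fun n => h 0 n - c n)%C
    (fun x => v 0 x - u0 x)%C _ r0' A22).
  - move=> m; apply: Rle_trans (Cmod_triangle _ _) _; rewrite Cmod_opp -a0.
    by have := hA 0 in2 m; have := aA2 0 in0 m; lra.
  - move=> x; apply: has_sum_ext (has_sum_minus (hv 0 in2 x) (hu0 x)) => m.
    by ring.
  - move=> x; rewrite v0; have -> : (u0 x - u0 x = 0)%C by ring.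
    by rewrite Cmod_0; lra.
have hd := coef_kdv nonres (Rlt_le _ _ A20) r0 hA hv vK.
pose T2 := Rmin T t2.
have T2T : T2 <= T := Rmin_l _ _; have T2t2 : T2 <= t2 := Rmin_r _ _.
have T20 : 0 < T2 by apply: Rmin_pos.
have [|||||t1 [[t10 t1T2] ab]] := @inter_unique _ omega a
  (fun t => twist omega (- t) (h t)) A2 r T2 A20 r0 T20.
- by move=> t tT; apply: aA2; lra.
- by move=> t tT; apply: twist_wbounded; apply: hA; lra.
- move=> t n tT; have tT' : 0 <= t < T by lra.
  by apply: derw_sub (ad t n tT') => s; lra.
- move=> t n tT; apply: untwist_derw; have tT' : 0 <= t < t2 by lra.
  by apply: derw_sub (hd t n tT') => s; lra.
- by move=> n; rewrite a0 /twist Ropp_0 Rmult_0_l expi0 h0 Cmult_1_l.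
exists t1; split=> //; split; first by lra.
split; first by lra.
move=> t x tt1; have tT : 0 <= t < T by lra.
have tt2 : 0 <= t < t2 by lra.
apply: has_sum_unique (hv t tt2 x) _.
apply: has_sum_ext (uq t tT x) => n; congr Cmult.
by rewrite -[RHS](twistK omega t) /ct {1}/twist (ab t n tt1).
Qed.
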